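(* There exist an absolute constant $C>0$ and an integer $h_0$ such that the following holds. Define $$G(h)=\exp\left(h^{182}\cdot\exp\left(\left(C e^{h^{32770}}\right)^{h(h+1)-1}\right)\right).$$ Let $h\ge h_0$ be an integer and let $X,Y$ be finite sets of positive integers with $\frac{1}{h^{29}}|Y|\geq|X|\geq G(h)$. Then $Y$ contains a subset $Z$ of size $h$ which is disjoint from $X$ and is sum-free with respect to $X\cup Y$.
   Context: For finite sets of numbers $S$ and $B$, $B$ is sum-free with respect to $S$ if the set $\{b+b' : b,b'\in B,\ b\neq b'\}$ is disjoint from $S$. *)

(* Defs.v *)
From mathcomp Require Import all_boot all_order all_algebra.
From mathcomp Require Import finmap.
From mathcomp Require Import reals sequences exp.

Set Implicit Arguments.
Unset Strict Implicit.
Unset Printing Implicit Defensive.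

Import Order.TTheory GRing.Theory Num.Theory.

Local Open Scope ring_scope.

Definition distinct_sums (B : {fset nat}) : {fset nat} :=
  [fset (p.1 + p.2)%N | p in (B `*` B)%fset & p.1 != p.2]%fset.

(* [sum_free_wrt S B] reads: B is sum-free with respect to S. *)
Definition sum_free_wrt (S B : {fset nat}) : bool :=
  [disjoint distinct_sums B & S]%fset.

(* The truncated subtraction in the exponent is harmless for h > 0. *)
Definition G {R : realType} (C : R) (h : nat) : R :=
  expR (h%:R ^+ 182 *
        expR ((C * expR (h%:R ^+ 32770)) ^+ (h * (h + 1) - 1)%N)).

(* Main.v *)
Require Import Defs.
From mathcomp Require Import all_boot all_order all_algebra all_field.
From mathcomp Require Import zify ring.
From mathcomp Require Import finmap.
From mathcomp Require Import reals sequences exp.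

(** Suppose that no such [Z] exists and put [S = X ∪ Y]. The graph on [Y \ X]
    joining [x] and [y] when [x + y ∈ S] has no independent set of size [h], so
    by Turán it, and each of its large induced subgraphs, is dense.

    Since [x + y] has the smaller of the two 2-adic valuations of [x] and [y]
    when these differ, density forces a large part [V] of [Y \ X] to have
    constant valuation. The sets [2^j V] are then disjoint, so most elements of
    [V] leave [S] after a bounded number of doublings. Dilating the elements
    which leave at the same time gives a large [A ⊆ Y \ X] such that [2a ∉ S]
    for every [a ∈ A].

    Density on [A] and the Balog–Szemerédi–Gowers, Plünnecke (in the form of
    Petridis) and Ruzsa modelling arguments then transport a large subset of [A]
    to a dense subset [B] of an interval [[0, N)], preserving the relation
    [x + x' = 2y]. Finally [B] contains [h] points all of whose midpoints are
    in [B]: either such points can be chosen greedily, or the graph of pairs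
    with midpoint in [B] is sparse on a large set, hence [B] has a large Fourier
    coefficient and therefore increased density on a progression. The
    corresponding [h] elements of [A] have pairwise sums of the form [2a],
    which are not in [S]. *)

Set Implicit Arguments.
Unset Strict Implicit.
Unset Printing Implicit Defensive.

Import Order.TTheory GRing.Theory Num.Theory.

(** * Dense sum graphs on integers *)

(** Induction on [k]. The closed neighbourhood [Nx] of a vertex [x] of least degree contributes at
    least |Nx|^2 to the degree sum, and an independent subset of its complement [W] can be extended
    by [x], so the bound for [k] applies to [W]. *)
Lemma turan_independence (T : finType) (r : rel T) (k : nat) (V : {set T}) :
  reflexive r -> symmetric r ->
  (forall Z : {set T}, Z \subset V ->
     {in Z &, forall x y, r x y -> x = y} -> #|Z| <= k) ->
  #|V| ^ 2 <= k * \sum_(x in V) #|[set y in V | r x y]|.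
Proof.
move=> rr rs; elim: k V => [|k IH] V hV.
  case: (set_0Vmem V) => [->|[x xV]]; first by rewrite cards0.
  suff: 1 <= 0 by [].
  rewrite -(cards1 x); apply: hV; first by rewrite sub1set.
  by move=> y z /set1P -> /set1P ->.
case: (set_0Vmem V) => [->|[x0 x0V]]; first by rewrite cards0.
pose deg y := #|[set z in V | r y z]|.
case: (arg_minnP deg x0V) => x; move=> xV0 xmin; have xV : x \in V by [].
pose Nx := [set y in V | r x y]; pose W := V :\: Nx.
have NV : Nx \subset V by apply/subsetP => y; rewrite inE => /andP[].
have WV : W \subset V by exact: subsetDl.
have cV : #|V| = #|Nx| + #|W| by rewrite (cardsD V Nx) (setIidPr NV) subnKC // subset_leq_card.
have hW := IH W.
have /hW{}hW : forall Z : {set T}, Z \subset W ->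
    {in Z &, forall x y, r x y -> x = y} -> #|Z| <= k.
  move=> Z ZW Zi.
  have nrx y : y \in Z -> ~~ r x y.
    by move=> /(subsetP ZW); rewrite !inE => /andP[+ yV]; rewrite yV.
  have xZ : x \notin Z by apply/negP => /nrx; rewrite rr.
  have := hV (x |: Z); rewrite cardsU1 xZ add1n ltnS; apply.
    by rewrite subUset sub1set xV (subset_trans ZW).
  move=> a b /setU1P[->|aZ] /setU1P[->|bZ] //; last exact: Zi.
    by move=> rab; have := nrx _ bZ; rewrite rab.
  by rewrite rs => rab; have := nrx _ aZ; rewrite rab.
have : \sum_(x in V) deg x >= #|Nx| * #|Nx| + \sum_(x in W) #|[set y in W | r x y]|.
  rewrite [X in _ <= X](big_setID Nx) (setIidPr NV); apply: leq_add.
    rewrite -sum_nat_const; apply: leq_sum => y yN; apply: xmin.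
    exact: (subsetP NV).
  apply: leq_sum => y _; apply: subset_leq_card; apply/subsetP => z.
  by rewrite !inE => /andP[/andP[_ ->] ->].
rewrite -[\sum_(x in V) _]/(\sum_(x in V) deg x) cV; move: (\sum_(i in V) _) (\sum_(i in W) _) hW => s s' hW hs.
apply: (leq_trans _ (leq_mul (leqnn k.+1) hs)).
case: k {IH hV hs} hW => [|k] hW; first by nia.
(* With a = |Nx| and w = |W|, this is equivalent to (a + w)^2 <= (k + 2)(a^2 + w^2 / (k + 1)). *)
have : (k.+1 * #|Nx|)%N ^ 2 + #|W| ^ 2 >= 2 * (k.+1 * #|Nx|) * #|W|.
  by rewrite -mulnA; exact: nat_Cauchy.
nia.
Qed.

Lemma logn_addl p x y : prime p -> 0 < x -> 0 < y -> logn p x < logn p y ->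
  logn p (x + y) = logn p x.
Proof.
move=> pp x0 y0 lt.
have xy0 : 0 < x + y by lia.
have dx : p ^ (logn p x) %| x by exact: pfactor_dvdnn.
have dy e : e <= logn p y -> p ^ e %| y by move=> h; rewrite pfactor_dvdn.
apply/eqP; rewrite eqn_leq -(pfactor_dvdn _ pp xy0) dvdn_add ?dy ?(ltnW lt) // andbT.
rewrite leqNgt -(pfactor_dvdn _ pp xy0) dvdn_addl ?dy //.
by rewrite pfactor_dvdn // ltnn.
Qed.

Lemma card_set_sum (T : finType) (A : {set T}) (P : pred T) :
  #|[set x in A | P x]| = \sum_(x in A) P x.
Proof.
rewrite -sum1_card big_mkcond [RHS]big_mkcond; apply: eq_bigr => x _.
by rewrite inE; case: (x \in A); case: (P x).
Qed.

Lemma sum_le_const (T : finType) (A : {set T}) (F : T -> nat) m :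
  (forall x, x \in A -> F x <= m) -> \sum_(x in A) F x <= #|A| * m.
Proof. by move=> h; rewrite -sum_nat_const; apply: leq_sum. Qed.

(* If [x] and [y] have different 2-adic valuations then [x + y] has the smaller
   of the two, so a sum in [S] determines the class of one of the summands. *)
Lemma large_valuation_class (M k : nat) (U S : {set 'I_M}) (r : rel 'I_M) :
  (forall x, x \in U -> 0 < x) ->
  (forall x y, r x y -> (x == y) || [exists s in S, val s == x + y]) ->
  #|U| ^ 2 <= k * \sum_(x in U) #|[set y in U | r x y]| ->
  exists v, #|U| ^ 2 <=
    k * (#|U| + 2 * #|S|) * #|[set x in U | logn 2 x == v]|.
Proof.
move=> U0 hr hk.
pose cl v := #|[set x in U | logn 2 x == v]|.
(* [v] is a valuation with the largest class in [U]; it dominates every class met below. *)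
have [v vmax] : exists v, forall x, cl (logn 2 (x : 'I_M)) <= cl v.
  case: M U S r U0 hr hk @cl => [|M] U S r U0 hr hk cl; first by exists 0 => -[].
  case: (@arg_maxnP _ ord0 xpredT (fun x : 'I_M.+1 => cl (logn 2 x))) => // v _ h.
  by exists (logn 2 v) => x; apply: h.
exists v; apply: (leq_trans hk); rewrite -mulnA leq_mul2l; apply/orP; right.
rewrite -/(cl v).
pose up (x y : 'I_M) := (logn 2 x < logn 2 y) && [exists s in S, val s == x + y].
have rsplit x y : r x y -> [|| logn 2 x == logn 2 y, up x y | up y x].
  move=> /hr /orP[/eqP->|h]; first by rewrite eqxx.
  rewrite /up h [y + x]addnC h !andbT.
  by case: ltngtP.
(* For fixed [x], adding [x] injects these [y] into the elements of [S] with the valuation of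
   [x]. *)
have upS x : x \in U -> #|[set y in U | up x y]| <= #|[set s in S | logn 2 s == logn 2 x]|.
  move=> xU; pose f (y : 'I_M) : 'I_M := insubd y (x + y).
  have vf y : up x y -> val (f y) = x + y.
    by move=> /andP[_ /existsP[s /andP[_ /eqP es]]]; rewrite /f val_insubd -es ltn_ord.
  rewrite -(@card_in_imset _ _ f); last first.
    move=> y z; rewrite !inE => /andP[_ hy] /andP[_ hz] e; apply: val_inj.
    by apply/eqP; rewrite -(eqn_add2l x) -(vf y hy) -(vf z hz) e.
  apply: subset_leq_card; apply/subsetP => _ /imsetP[y + ->]; rewrite !inE => /andP[yU h].
  have := h => /andP[lt /existsP[s /andP[sS /eqP es]]].
  have -> : f y = s by apply: val_inj; rewrite vf.
  by rewrite sS es logn_addl ?eqxx // U0.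
have sumup : \sum_(x in U) #|[set y in U | up x y]| <= #|S| * cl v.
  apply: (leq_trans (leq_sum _ upS)).
  under eq_bigr do rewrite card_set_sum.
  rewrite exchange_big /=; apply: sum_le_const => s _.
  apply: leq_trans (vmax s); rewrite /cl card_set_sum.
  by apply: leq_sum => x _; rewrite eq_sym.
have sumdn : \sum_(x in U) #|[set y in U | up y x]| <= #|S| * cl v.
  apply: leq_trans sumup; under eq_bigr do rewrite card_set_sum.
  by rewrite exchange_big /=; under eq_bigr do rewrite -card_set_sum.
have sumeq : \sum_(x in U) #|[set y in U | logn 2 x == logn 2 y]| <= #|U| * cl v.
  apply: sum_le_const => x _; apply: leq_trans (vmax x).
  by apply: subset_leq_card; apply/subsetP => y; rewrite !inE [_ == logn 2 y]eq_sym.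
apply: leq_trans (_ : _ <= \sum_(x in U) (#|[set y in U | logn 2 x == logn 2 y]| +
   #|[set y in U | up x y]| + #|[set y in U | up y x]|)) _.
  apply: leq_sum => x _; rewrite !card_set_sum -!big_split /=.
  by apply: leq_sum => y _; move: (rsplit x y); case: (r x y); case: (_ == _); case: (up x y); case: (up y x) => // /(_ isT).
rewrite !big_split /=.
have -> : (#|U| + 2 * #|S|) * cl v = #|U| * cl v + #|S| * cl v + #|S| * cl v by lia.
by rewrite !leq_add.
Qed.

(* The sets [2 ^ j * V] are pairwise disjoint, because [V] has constant 2-adic valuation. *)
Lemma doubling_exit (M v : nat) (V S : {set 'I_M}) :
  (forall x, x \in V -> 0 < x /\ logn 2 x = v) ->
  V \subset S -> 
  let inS n := [exists s in S, val s == n] in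
  exists k, #|V| ^ 2 <=
    4 * #|S| * #|[set x in V | inS (2 ^ k * x) && ~~ inS (2 ^ k.+1 * x)]|.
Proof.
move=> hV VS inS.
(* [W j] consists of the points that survive [j] doublings. Its dilate by 2^j lies in the part of
   [S] of valuation j + v, so the sizes of all [W j] sum to at most |S|. *)
pose W j := [set x in V | [forall i : 'I_j.+1, inS (2 ^ i * x)]].
have WS j x : x \in W j -> forall i, i <= j -> inS (2 ^ i * x).
  by rewrite inE => /andP[_ /forallP h] i ij; have := h (Ordinal (ij : i < j.+1)).
have W0 : W 0 = V.
  apply/setP => x; rewrite inE; case xV: (x \in V) => //=; apply/forallP => -[[|//] _] /=.
  by apply/existsP; exists x; rewrite (subsetP VS) //= expn0 mul1n eqxx.
have WSS j : W j.+1 \subset W j.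
  apply/subsetP => x xW; have := WS _ _ xW; move: xW; rewrite !inE => /andP[-> _] h /=.
  by apply/forallP => i; apply: h; rewrite leqW // -ltnS.
have Wc j : #|W j| <= #|[set s in S | logn 2 s == j + v]|.
  pose f (y : 'I_M) : 'I_M := insubd y (2 ^ j * y).
  have vf y : y \in W j -> val (f y) = 2 ^ j * y.
    move=> /WS /(_ j (leqnn j)) /existsP[s /andP[_ /eqP es]].
    by rewrite /f val_insubd -es ltn_ord.
  rewrite -(@card_in_imset _ _ f); last first.
    move=> y z hy hz e; apply: val_inj; apply/eqP.
    by rewrite -(@eqn_pmul2l (2 ^ j)) ?expn_gt0 // -(vf y hy) -(vf z hz) e.
  apply: subset_leq_card; apply/subsetP => _ /imsetP[y yW ->].
  have /existsP[s /andP[sS /eqP es]] := WS _ _ yW j (leqnn j).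
  have -> : f y = s by apply: val_inj; rewrite vf.
  have [y0 yv] : 0 < y /\ logn 2 y = v by apply: hV; move: yW; rewrite inE => /andP[].
  by rewrite inE sS es lognM ?expn_gt0 // lognX logn_prime // eqxx muln1 yv eqxx.
have sumW J : \sum_(j < J) #|W j| <= #|S|.
  apply: leq_trans (leq_sum _ (fun (j : 'I_J) _ => Wc j)) _.
  under eq_bigr do rewrite card_set_sum.
  rewrite exchange_big /= -[#|S|]muln1; apply: sum_le_const => s _.
  case: (boolP [exists j : 'I_J, logn 2 s == j + v]) => [/existsP[j /eqP ej]|/existsPn h].
    rewrite (bigD1 j) //= big1 ?addn0 ?leq_b1 // => i ij.
    rewrite ej eqn_add2r; case: eqP => // e; case/negP: ij; apply/eqP/val_inj.
    exact: esym e.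
  by rewrite big1 // => j _; rewrite (negbTE (h j)).
have Wanti i j : i <= j -> #|W j| <= #|W i|.
  move=> /subnK <-; elim: (j - i) => // d /(leq_trans _); apply.
  by apply: subset_leq_card; rewrite addSn.
pose D j := [set x in V | inS (2 ^ j * x) && ~~ inS (2 ^ j.+1 * x)].
have WD j : #|W j| <= #|W j.+1| + #|D j|.
  rewrite -(cardsID (W j.+1) (W j)) leq_add //; apply: subset_leq_card.
    exact: subsetIr.
  apply/subsetP => x; rewrite inE => /andP[nx xW].
  have xV : x \in V by move: xW; rewrite inE => /andP[].
  rewrite inE xV (WS _ _ xW j) //=; apply: contra nx => h.
  rewrite inE xV /=; apply/forallP => -[i /= ij].
  move: (ij); rewrite ltnS leq_eqVlt => /orP[/eqP -> //|lt].
  exact: (WS _ _ xW).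
have WDs J : #|V| <= #|W J| + \sum_(j < J) #|D j|.
  elim: J => [|J IH]; first by rewrite W0 big_ord0 addn0.
  rewrite big_ord_recr addnCA addnC; apply: (leq_trans IH).
  by rewrite leq_add2r; exact: WD.
case: (posnP #|V|) => [->|V0]; first by exists 0.
have VleS := subset_leq_card VS.
(* This many steps force |W J| <= |S| / (J + 1) < |V| / 2. More than half of [V] then exits during
   [J] steps, and some single step accounts for at least |V|^2 / (4|S|) exits. *)
pose J := (2 * #|S|) %/ #|V|.
case: (boolP [exists j : 'I_J, #|V| ^ 2 <= 4 * #|S| * #|D j|]) => [/existsP[j h]|/existsPn h].
  by exists j.
have hJ1 : J * #|V| <= 2 * #|S| by exact: leq_trunc_div.
have hJ2 : 2 * #|S| < J.+1 * #|V| by rewrite ltn_ceil.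
have hWJ : J.+1 * #|W J| <= #|S|.
  apply: leq_trans (sumW J.+1).
  have : \sum_(j < J.+1) #|W J| <= \sum_(j < J.+1) #|W j|.
    by apply: leq_sum => j _; apply: Wanti; rewrite -ltnS.
  by rewrite sum_nat_const card_ord.
have J0 : 0 < J by rewrite divn_gt0 //; lia.
have hD : 4 * #|S| * \sum_(j < J) #|D j| + J <= J * #|V| ^ 2.
  have : \sum_(j < J) (4 * #|S| * #|D j| + 1) <= \sum_(j < J) #|V| ^ 2.
    by apply: leq_sum => j _; rewrite addn1 ltnNge; apply: h.
  by rewrite big_split /= !sum_nat_const card_ord muln1 -big_distrr.
have := WDs J; move: (\sum_(j < J) _) hD => D' hD hm; exfalso.
have hw : 2 * #|W J| < #|V|.
  by rewrite -(@ltn_pmul2l J.+1) // (leq_ltn_trans _ hJ2) // mulnCA leq_mul2l hWJ.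
have : 4 * #|S| * #|V| + J <= 4 * #|S| * #|W J| + 2 * #|S| * #|V|.
  apply: leq_trans (_ : _ <= 4 * #|S| * #|W J| + (4 * #|S| * D' + J)) _.
    by rewrite addnA leq_add2r -mulnDr leq_mul2l hm orbT.
  by rewrite leq_add2l (leq_trans hD) // -mulnn mulnA leq_mul2r hJ1 orbT.
move: J0 hw; move: (#|W J|) (#|S|) (#|V|) (J) => w s m j; clear; nia.
Qed.

(** * Sumsets in finite abelian groups *)

Lemma sum_sqr_le (T : finType) (A : {set T}) (F : T -> nat) :
  (\sum_(x in A) F x) ^ 2 <= #|A| * \sum_(x in A) F x ^ 2.
Proof.
rewrite -(leq_pmul2l (isT : 0 < 2)) -mulnn big_distrl /= big_distrr /=.
apply: leq_trans (_ : _ <= \sum_(x in A) \sum_(y in A) (F x ^ 2 + F y ^ 2)) _.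
  apply: leq_sum => x _; rewrite big_distrr big_distrr /=.
  by apply: leq_sum => y _; exact: nat_Cauchy.
under eq_bigr do rewrite big_split /= sum_nat_const.
by rewrite big_split /= -big_distrr /= sum_nat_const mul2n addnn.
Qed.

Lemma exists_le_sum (T : finType) (A : {set T}) (F H : T -> nat) :
  A != set0 -> \sum_(x in A) F x <= \sum_(x in A) H x ->
  exists2 x, x \in A & F x <= H x.
Proof.
move=> /set0Pn[x0 x0A] h.
case: (boolP [exists x in A, F x <= H x]) => [/existsP[x /andP[]]|/existsPn n]; first by exists x.
suff: \sum_(x in A) H x < \sum_(x in A) F x by rewrite ltnNge h.
have lt x : x \in A -> H x < F x by move=> xA; have := n x; rewrite xA -ltnNge.
rewrite (bigD1 x0) // [X in _ < X](bigD1 x0) //= -addSn leq_add ?lt //.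
by apply: leq_sum => x /andP[xA _]; exact: ltnW (lt _ xA).
Qed.

Section Sumset.
Variable gT : finZmodType.
Implicit Types A B C D S X : {set gT}.

Definition sumset A B : {set gT} := [set (x + y)%R | x in A, y in B].
Definition oppset A : {set gT} := [set (- x)%R | x in A].

Lemma sumsetP A B z :
  reflect (exists x y, [/\ x \in A, y \in B & z = (x + y)%R]) (z \in sumset A B).
Proof.
apply: (iffP imset2P) => [[x y xA yB ->]|[x [y [xA yB ->]]]]; first by exists x, y.
by exists x y.
Qed.

Lemma mem_sumset A B x y : x \in A -> y \in B -> (x + y)%R \in sumset A B.
Proof. by move=> xA yB; apply/sumsetP; exists x, y. Qed.

Lemma mem_oppset A x : ((- x)%R \in oppset A) = (x \in A).
Proof. by rewrite mem_imset //; exact: oppr_inj. Qed.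

Lemma card_oppset A : #|oppset A| = #|A|.
Proof. by rewrite card_imset //; exact: oppr_inj. Qed.

Lemma sumsetS A A' B B' : A \subset A' -> B \subset B' -> sumset A B \subset sumset A' B'.
Proof.
by move=> /subsetP sA /subsetP sB; apply/subsetP => _ /sumsetP[x [y [/sA xA /sB yB ->]]]; exact: mem_sumset.
Qed.

Lemma sumsetC A B : sumset A B = sumset B A.
Proof.
by apply/setP => z; apply/sumsetP/sumsetP => -[x [y [xA yB ->]]]; exists y, x; rewrite addrC.
Qed.

Lemma sumsetA A B C : sumset A (sumset B C) = sumset (sumset A B) C.
Proof.
apply/setP => z; apply/sumsetP/sumsetP.
  move=> [x [_ [xA /sumsetP[y [t [yB tC ->]]] ->]]].
  by exists (x + y)%R, t; rewrite mem_sumset // addrA.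
move=> [_ [t [/sumsetP[x [y [xA yB ->]]] tC ->]]].
by exists x, (y + t)%R; rewrite mem_sumset // addrA.
Qed.

Lemma oppset_sumset A B : oppset (sumset A B) = sumset (oppset A) (oppset B).
Proof.
apply/setP => z; rewrite -[in LHS](opprK z) mem_oppset; apply/sumsetP/sumsetP.
  by move=> [x [y [xA yB e]]]; exists (- x)%R, (- y)%R; rewrite !mem_oppset -opprD -e opprK.
move=> [x [y [xA yB ->]]]; exists (- x)%R, (- y)%R.
by rewrite -(mem_oppset A) -(mem_oppset B) !opprK opprD.
Qed.

Lemma oppsetK : involutive oppset.
Proof. by move=> A; apply/setP => z; rewrite -[in LHS](opprK z) !mem_oppset. Qed.

Lemma sumset0 A : sumset A set0 = set0.
Proof. by apply/setP => z; rewrite inE; apply/negP => /sumsetP[x [y [_]]]; rewrite inE. Qed.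

Lemma card_sumset1 A x : #|sumset A [set x]| = #|A|.
Proof.
rewrite -(card_imset (mem A) (addIr x)); congr #|pred_of_set _|; apply/setP => z.
apply/sumsetP/imsetP => [[a [y [aA /set1P -> ->]]]|[a aA ->]]; first by exists a.
by exists a, x; rewrite set11.
Qed.

(** Fix a representation d = a - c of each difference. The map (b, d) to (a - b, b - c) is
    injective: the sum of the two coordinates recovers d, hence a, and then b. *)
Lemma ruzsa_triangle A B C :
  #|B| * #|sumset A (oppset C)| <= #|sumset A (oppset B)| * #|sumset B (oppset C)|.
Proof.
pose rep d := odflt (0, 0)%R [pick p | (p.1 \in A) && (p.2 \in C) && (d == (p.1 - p.2)%R)].
have repP d : d \in sumset A (oppset C) -> [/\ (rep d).1 \in A, (rep d).2 \in C & d = ((rep d).1 - (rep d).2)%R].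
  move=> /sumsetP[x [y [xA yC e]]]; rewrite /rep; case: pickP => [p /andP[/andP[-> ->] /eqP ->] //|].
  by move=> /(_ (x, - y)%R) /=; rewrite xA -mem_oppset opprK yC e eqxx.
pose f (p : gT * gT) := (((rep p.2).1 - p.1)%R, (p.1 - (rep p.2).2)%R).
rewrite -!cardsX -(@card_in_imset _ _ f).
  apply: subset_leq_card; apply/subsetP => _ /imsetP[[b d] /setXP[/= bB /repP[rA rC _]] ->].
  by rewrite /f /=; apply/setXP; rewrite /= !mem_sumset ?mem_oppset.
move=> [b d] [b' d'] /setXP[/= _ /repP[_ _ e]] /setXP[/= _ /repP[_ _ e']] [h1 h2].
have ed : d = d' by rewrite e e' -(subrK b (rep d).1) h1 -addrA h2 addrA subrK.
by move: h1; rewrite ed => /addrI/oppr_inj ->.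
Qed.

(** Induction on [C], removing one element [c]. If X' is the set of [x] for which x + B + c is
    already covered, adding [c] creates at most |X + B| - |X' + B| new elements of X + B + C and at
    least |X| - |X'| new elements of X + C. Minimality of the ratio for [X], applied to X', compares
    the two. *)
Lemma petridis X B C :
  (forall Z : {set gT}, Z \subset X -> #|sumset X B| * #|Z| <= #|sumset Z B| * #|X|) ->
  #|sumset (sumset X B) C| * #|X| <= #|sumset X B| * #|sumset X C|.
Proof.
move=> hX; have [n] := ubnP #|C|; elim: n C => // n IH C Cn.
case: (set_0Vmem C) => [->|[c cC]]; first by rewrite !sumset0 cards0.
pose C' := C :\ c.
have {}IH : #|sumset (sumset X B) C'| * #|X| <= #|sumset X B| * #|sumset X C'|.
  by apply: IH; move: Cn; rewrite (cardsD1 c C) cC.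
have eC D : sumset D C = sumset D C' :|: sumset D [set c].
  rewrite -(setD1K cC) -/C'; apply/setP => z; rewrite inE; apply/sumsetP/orP.
    by move=> [x [y [xD /setU1P[->|yC] ->]]]; [right|left]; rewrite mem_sumset ?set11.
  by move=> [] /sumsetP[x [y [xD yC ->]]]; exists x, y; rewrite in_setU yC ?orbT.
pose X' := [set x in X | [forall b in B, (x + b + c)%R \in sumset (sumset X B) C']].
have X'X : X' \subset X by apply/subsetP => x; rewrite inE => /andP[].
have h1 : #|sumset (sumset X B) C| + #|sumset X' B| <= #|sumset (sumset X B) C'| + #|sumset X B|.
  rewrite eC -(card_sumset1 (sumset X' B) c) -(card_sumset1 (sumset X B) c).
  rewrite -[X in _ <= X]cardsUI leq_add2l subset_leq_card // subsetI; apply/andP; split.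
    apply/subsetP => _ /sumsetP[_ [_ [/sumsetP[x [b [xX bB ->]]] /set1P -> ->]]].
    by move: xX; rewrite inE => /andP[_ /forallP/(_ b)]; rewrite bB.
  by rewrite sumsetS // sumsetS.
have h2 : #|sumset X C'| + #|X| <= #|sumset X C| + #|X'|.
  rewrite eC -(card_sumset1 X c) -(card_sumset1 X' c) -[X in X <= _]cardsUI leq_add2l subset_leq_card //.
  apply/subsetP => z; rewrite inE => /andP[zC' /sumsetP[x [_ [xX /set1P -> ez]]]].
  rewrite ez mem_sumset ?set11 // inE xX; apply/forallP => b; apply/implyP => bB.
  move: zC'; rewrite ez => /sumsetP[y [d [yX dC e]]].
  by rewrite addrAC e addrAC !mem_sumset.
have h3 := hX _ X'X.
have h4 : #|X'| <= #|X| := subset_leq_card X'X.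
move: h1 h2 h3 h4 IH.
move: #|sumset (sumset X B) C| #|sumset X' B| #|sumset (sumset X B) C'| #|sumset X B|.
move: #|sumset X C'| #|sumset X C| #|X| #|X'| => f g x x' a b d e; clear.
nia.
Qed.

(** For B = -A and a minimising [X], Petridis with C = B gives |X + B + B| <= K^2 |X|. The Ruzsa
    triangle inequality through [X] bounds |X| |2A - 2A| by |X - 2A|^2, which is at most K^4
    |X|^2. *)
Lemma plunnecke_double_difference A K : A != set0 ->
  #|sumset A (oppset A)| <= K * #|A| ->
  #|sumset (sumset A A) (oppset (sumset A A))| <= K ^ 4 * #|A|.
Proof.
move=> A0 hK; pose B := oppset A.
(* Petridis: a subset of [A] minimising the growth ratio [|Z + B| / |Z|]. *)
have [X [XA X0 Xmin]] : exists X, [/\ X \subset A, X != set0 &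
    forall Z : {set gT}, Z \subset A -> #|sumset X B| * #|Z| <= #|sumset Z B| * #|X|].
  (* The factorial of |A| clears the denominator: it is divisible by the size of every nonempty
     subset, so the ratio can be minimised in [nat]. *)
  pose w (Z : {set gT}) := #|sumset Z B| * ((#|A|)`! %/ #|Z|).
  pose P (Z : {set gT}) := (Z \subset A) && (Z != set0).
  have PA : P A by rewrite /P subxx.
  case: (arg_minnP w PA) => X /andP[XA X0] Xmin; exists X; split=> // Z ZA.
  have [->|Z0] := eqVneq Z set0; first by rewrite cards0 muln0.
  have dv (D : {set gT}) : D \subset A -> D != set0 -> (#|A|)`! %/ #|D| * #|D| = (#|A|)`!.
    by move=> DA D0; rewrite divnK // dvdn_fact // card_gt0 D0 subset_leq_card.
  have := Xmin Z; rewrite /P ZA Z0 => /(_ isT) h.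
  rewrite -(leq_pmul2r (fact_gt0 #|A|)).
  have := leq_mul h (leqnn (#|X| * #|Z|)); rewrite /w.
  move: (dv X XA X0) (dv Z ZA Z0).
  move: #|sumset X B| #|sumset Z B| #|X| #|Z| ((#|A|)`!) (_ %/ #|X|) (_ %/ #|Z|).
  clear => a b x z F f1 f2 e1 e2; rewrite -{2}e2 -{1}e1; lia.
have hX : #|sumset X B| <= K * #|X|.
  have := Xmin A (subxx _); rewrite -[#|sumset A B|]/(#|sumset A (oppset A)|).
  have : 0 < #|A| by rewrite card_gt0.
  move: (#|sumset X B|) (#|A|) hK; clear; nia.
have minX (Z : {set gT}) : Z \subset X -> #|sumset X B| * #|Z| <= #|sumset Z B| * #|X|.
  by move=> ZX; apply: Xmin; apply: subset_trans XA.
have XBB : #|sumset (sumset X B) B| <= K ^ 2 * #|X|.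
  have := petridis B minX; have : 0 < #|X| by rewrite card_gt0.
  move: hX; move: (#|sumset (sumset X B) B|) (#|sumset X B|) (#|X|); clear; nia.
have := ruzsa_triangle (sumset A A) X (sumset A A).
have -> : #|sumset X (oppset (sumset A A))| = #|sumset (sumset X B) B|.
  by rewrite oppset_sumset sumsetA.
have -> : #|sumset (sumset A A) (oppset X)| = #|sumset (sumset X B) B|.
  by rewrite -card_oppset oppset_sumset oppsetK oppset_sumset sumsetC sumsetA.
have : 0 < #|X| by rewrite card_gt0.
have := subset_leq_card XA; move: XBB.
move: #|sumset (sumset X B) B| #|X| #|A| => a x n; move: #|sumset _ _| => D; clear => h1 h2 h3 h4.
have h5 := leq_mul h1 h1.
have : x * D <= x * (K ^ 4 * x) by apply: leq_trans h4 (leq_trans h5 _); lia.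
rewrite leq_pmul2l // => /leq_trans; apply; exact: leq_mul.
Qed.

End Sumset.

(** * Balog-Szemerédi-Gowers theorem *)

Lemma sum_card_fibers (T U : finType) (A : {set T}) (B : {set U}) (f : T -> U) :
  \sum_(u in B) #|[set x in A | f x == u]| <= #|A|.
Proof.
under eq_bigr do rewrite card_set_sum.
rewrite exchange_big /= -[#|A|]muln1; apply: sum_le_const => x _.
rewrite (eq_bigr (fun u => if u == f x then 1 else 0)); last by move=> u _; rewrite eq_sym; case: eqP.
by rewrite -big_mkcondr /= sum1_card -(card1 (f x)) subset_leq_card //; apply/subsetP => u; rewrite inE => /andP[].
Qed.

(** Join two points of [A] when their sum is in [S]. Some large neighbourhood contains few pairs
    with few common neighbours; its well-connected points form [D]. Each difference over [D] then
    has at least m n^2 / (512 K^4) representations by quadruples from [S], and counting quadruples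
    bounds the difference set. *)
Lemma balog_szemeredi_gowers (gT : finZmodType) (A S : {set gT}) (K : nat) :
  A != set0 ->
  #|A| ^ 2 <= K * \sum_(x in A) #|[set y in A | (x + y)%R \in S]| ->
  exists D : {set gT}, [/\ D \subset A, #|A| <= 4 * K * #|D| &
    #|sumset D (oppset D)| * #|A| ^ 3 <= 1024 * K ^ 5 * #|S| ^ 4].
Proof.
move=> A0 hE; set n := #|A| in hE *.
have n0 : 0 < n by rewrite card_gt0.
pose N b := [set a in A | (b + a)%R \in S].
pose c x y := #|[set b in A | ((x + b)%R \in S) && ((y + b)%R \in S)]|.
have cC x y : c x y = c y x by apply: eq_card => b; rewrite !inE; congr andb; exact: andbC.
pose bad x y := 16 * K ^ 2 * c x y < n.
pose badN b := \sum_(x in N b) #|[set y in N b | bad x y]|.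
(* Cauchy-Schwarz for the degrees, whose sum is at least n^2 / K. *)
have hN2 : n ^ 3 <= K ^ 2 * \sum_(b in A) #|N b| ^ 2.
  have h1 := sum_sqr_le A (fun b => #|N b|); have h2 := leq_mul hE hE.
  rewrite -(leq_pmul2l n0); move: h1 h2; rewrite -/n -[\sum_(x in A) _]/(\sum_(x in A) #|N x|).
  by move: (\sum_(b in A) #|N b| ^ 2) (\sum_(b in A) #|N b|) => s2 s1; clear; nia.
(* Double counting: a bad pair lies in [N b] for exactly [c x y] values of [b], fewer than n / (16
   K^2). *)
have hbad : 16 * K ^ 2 * \sum_(b in A) badN b <= n ^ 3.
  have -> : \sum_(b in A) badN b = \sum_(x in A) \sum_(y in A | bad x y) c x y.
    rewrite /badN /c.
    transitivity (\sum_(b in A) \sum_(x in A) \sum_(y in A)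
       (((b + x)%R \in S) && ((b + y)%R \in S) && bad x y : nat)).
      apply: eq_bigr => b _; rewrite (big_mkcond (fun x => x \in N b)) [RHS]big_mkcond.
      apply: eq_bigr => x _; rewrite inE; case: (x \in A) => //=.
      case: (_ \in S); last by rewrite big1.
      rewrite card_set_sum (big_mkcond (fun y => y \in N b)) [RHS]big_mkcond /=.
      by apply: eq_bigr => y _; rewrite inE; case: (y \in A) => //=; case: (_ \in S).
    rewrite exchange_big; apply: eq_bigr => x _.
    rewrite exchange_big [RHS]big_mkcondr; apply: eq_bigr => y _ /=.
    case: (bad x y); last by rewrite big1 // => b _; rewrite andbF.
    by rewrite card_set_sum; apply: eq_bigr => b _; rewrite andbT ![(b + _)%R]addrC.
  have : \sum_(x in A) \sum_(y in A | bad x y) (16 * K ^ 2 * c x y) <= n * (n * n).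
    apply: sum_le_const => x _; rewrite big_mkcondr; apply: sum_le_const => y _.
    by case: ifP => // /ltnW.
  by rewrite big_distrr /=; under [X in _ -> X <= _]eq_bigr do rewrite big_distrr.
(* Dependent random choice of the neighbourhood [N b]. *)
have [b bA hb] : exists2 b, b \in A & 16 * K ^ 2 * badN b + n ^ 2 <= 2 * K ^ 2 * #|N b| ^ 2.
  apply: exists_le_sum => //; rewrite big_split /= sum_nat_const -!big_distrr /= -/n.
  move: hN2 hbad; move: (\sum_(i in A) badN i) (\sum_(i in A) _) => s t; clear; lia.
pose A' := N b; set m := #|A'|.
have hm1 : n ^ 2 <= 2 * K ^ 2 * m ^ 2 by apply: leq_trans hb; exact: leq_addl.
have m0 : 0 < m by case: (posnP m) hm1 => // ->; rewrite muln0; nia.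
have K0 : 0 < K by case: (posnP K) hm1 => // ->; rewrite muln0; nia.
have hm2 : 8 * badN b <= m ^ 2.
  have : 16 * K ^ 2 * badN b <= 2 * K ^ 2 * m ^ 2 by apply: leq_trans hb; exact: leq_addr.
  have : 0 < K ^ 2 by rewrite expn_gt0 K0.
  by move: (K ^ 2) (badN b) (m ^ 2); clear; nia.
have nKm : n <= 2 * K * m.
  have : n * n <= (2 * K * m) * (2 * K * m) by lia.
  by rewrite !mulnn leq_sqr.
(* By Markov at least half of [A'] survives. Any two survivors share at least m / 2 intermediate
   points that form a bad pair with neither. *)
pose D := [set x in A' | 4 * #|[set y in A' | bad x y]| <= m].
have DA' : D \subset A' by apply/subsetP => x; rewrite inE => /andP[].
have hmD : m <= 2 * #|D|.
  have : #|A' :\: D| * m <= 4 * badN b.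
    rewrite /badN big_distrr -sum_nat_const [X in _ <= X](big_setID D) -[X in X <= _]add0n; apply: leq_add => //.
    by apply: leq_sum => x; rewrite !inE => /andP[+ xA']; rewrite xA' -ltnNge => /ltnW.
  have := cardsID D A'; rewrite (setIidPr DA') -/m.
  by move: hm2 m0; move: (badN b) #|D| #|_ :\: _| (m); clear; nia.
exists D; split.
- by apply: subset_trans DA' _; apply/subsetP => x; rewrite inE => /andP[].
- by apply: leq_trans nKm _; rewrite -!mulnA; move: hmD; clear; nia.
pose Q := setX (setX S S) (setX S S).
have cQ : #|Q| = #|S| ^ 4 by rewrite !cardsX; lia.
pose f (q : (gT * gT) * (gT * gT)) : gT := (q.1.1 - q.1.2 + (q.2.1 - q.2.2))%R.
(* Paths of length 4 through [z] write [x - y] as [s1 - s2 + (s3 - s4)]. *)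
have key x y : x \in D -> y \in D ->
    m * n ^ 2 <= 512 * K ^ 4 * #|[set q in Q | f q == (x - y)%R]|.
  rewrite !inE => /andP[xA' hx] /andP[yA' hy].
  pose Z := [set z in A' | ~~ bad x z && ~~ bad z y].
  have hZ : m <= 2 * #|Z|.
    have h1 : #|A' :\: Z| <= #|[set z in A' | bad x z]| + #|[set z in A' | bad y z]|.
      rewrite -cardsUI; apply: leq_trans (leq_addr _ _); apply: subset_leq_card.
      have mZ z : (z \in Z) = (z \in A') && (~~ bad x z && ~~ bad z y) by rewrite inE.
      have mB u z : (z \in [set z in A' | bad u z]) = (z \in A') && bad u z by rewrite inE.
      apply/subsetP => z; rewrite in_setD mZ in_setU !mB => /andP[+ zA'].
      by rewrite zA' /= /bad [c z y]cC negb_and !negbK.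
    have := cardsID Z A'; have -> : A' :&: Z = Z.
      by apply/setIidPr/subsetP => z; rewrite inE => /andP[].
    by rewrite -/m; lia.
  pose C u w := [set b in A | ((u + b)%R \in S) && ((w + b)%R \in S)].
  pose P := [set p : gT * (gT * gT) | (p.1 \in Z) && (p.2 \in setX (C x p.1) (C p.1 y))].
  have cP : #|P| = \sum_(z in Z) c x z * c z y.
    rewrite -sum1_card; under [RHS]eq_bigr do rewrite -cardsX -sum1_card.
    by rewrite pair_big_dep; apply: eq_bigl => p; rewrite inE.
  have hP : m * n ^ 2 <= 512 * K ^ 4 * #|P|.
    have : #|Z| * (n * n) <= \sum_(z in Z) (16 * K ^ 2 * c x z) * (16 * K ^ 2 * c z y).
      rewrite -sum_nat_const; apply: leq_sum => z; rewrite inE /bad -!leqNgt => /andP[_ /andP[? ?]].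
      exact: leq_mul.
    rewrite cP; under eq_bigr do rewrite mulnACA.
    rewrite -big_distrr /=; move: hZ; move: (\sum_(i in Z) _) #|Z| => s z; clear; nia.
  apply: (leq_trans hP); rewrite leq_mul2l; apply/orP; right.
  pose g (p : gT * (gT * gT)) := (((x + p.2.1)%R, (p.1 + p.2.1)%R), ((p.1 + p.2.2)%R, (y + p.2.2)%R)).
  rewrite -(@card_imset _ _ g); last first.
    move=> [z [b1 b2]] [z' [b1' b2']] [] /addrI -> /addIr -> /addrI -> _ //.
  apply: subset_leq_card; apply/subsetP => _ /imsetP[[z [b1 b2]] + ->].
  rewrite !inE /= => /andP[_ /andP[/andP[_ /andP[-> ->]] /andP[_ /andP[-> ->]]]] /=.
  have e (u v w : gT) : (u + w - (v + w) = u - v)%R by rewrite opprD addrACA subrr addr0.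
  by rewrite /f /= !e addrA subrK.
have hsum : #|sumset D (oppset D)| * (m * n ^ 2) <= 512 * K ^ 4 * #|S| ^ 4.
  rewrite -sum_nat_const -cQ.
  apply: leq_trans (leq_mul (leqnn _) (sum_card_fibers Q (sumset D (oppset D)) f)).
  rewrite big_distrr /=; apply: leq_sum => _ /sumsetP[x [y [xD yD ->]]].
  by have := key x (- y)%R xD; rewrite -mem_oppset !opprK; apply.
apply: leq_trans (_ : _ <= 2 * K * (#|sumset D (oppset D)| * (m * n ^ 2))) _.
  by rewrite expnS (leq_trans (leq_mul (leqnn _) (leq_mul nKm (leqnn _)))) //; lia.
by apply: leq_trans (leq_mul (leqnn _) hsum) _; lia.
Qed.

(** * Modelling in an interval *)

Lemma card_multiples (m N : nat) : 0 < N ->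
  #|[set i : 'I_m.+1 | (i != 0 :> nat) && (N %| i)]| * N <= m.
Proof.
move=> N0; set B := [set i | _].
suff: #|B| <= m %/ N by rewrite leq_divRL.
pose f (i : 'I_m.+1) : 'I_(m %/ N).+1 := inord (i %/ N).
have vf i : f i = i %/ N :> nat by rewrite inordK // ltnS leq_div2r // -ltnS.
rewrite -(@card_in_imset _ _ f); last first.
  move=> i j; rewrite !inE => /andP[_ /divnK di] /andP[_ /divnK dj] e; apply: val_inj.
  by rewrite /= -di -dj -!vf e.
apply: (@leq_trans #|[set~ (ord0 : 'I_(m %/ N).+1)]|); last by rewrite cardsC1 card_ord.
apply: subset_leq_card; apply/subsetP => _ /imsetP[i + ->]; rewrite !inE => /andP[i0 dv].
by rewrite -val_eqE /= vf -lt0n divn_gt0 // dvdn_leq // lt0n.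
Qed.

(** A nonzero [d] rules out at most (p - 1) / N dilations, one for each nonzero multiple of [N]
    below [p]. Since |D| < N, some nonzero dilation is left. *)
Lemma dilation_avoiding_multiples (p N : nat) (D : {set 'F_p}) : prime p -> #|D| < N ->
  exists2 l : 'F_p, l != 0%R & forall d, d \in D -> d != 0%R -> ~~ (N %| (l * d)%R).
Proof.
move=> pp DN; have cF : (Zp_trunc (pdiv p)).+2 = p by exact: Fp_cast.
have N0 : 0 < N by exact: leq_ltn_trans DN.
pose B := [set r : 'F_p | (r != 0 :> nat) && (N %| r)].
have hB : #|B| * N <= p.-1.
  by have := @card_multiples (Zp_trunc (pdiv p)).+1 N N0; rewrite -[X in _ <= X.-1]cF.
pose bad d := [set l : 'F_p | (l * d)%R \in B].
have cbad d : d != 0%R -> #|bad d| <= #|B|.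
  move=> d0; rewrite -(card_imset (mem (bad d)) (mulIf d0)) subset_leq_card //.
  by apply/subsetP => _ /imsetP[l + ->]; rewrite [l \in _]inE.
pose L := \bigcup_(d in D :\ 0%R) bad d.
have cL : #|L| * N <= #|D| * p.-1.
  have h : #|L| <= \sum_(d in D :\ 0%R) #|bad d|.
    rewrite /L; elim/big_rec2: _ => [|d m U _ h]; first by rewrite cards0.
    by apply: leq_trans (leq_card_setU _ _) _; rewrite leq_add2l.
  have h2 : \sum_(d in D :\ 0%R) #|bad d| <= #|D| * #|B|.
    apply: leq_trans (sum_le_const (m := #|B|) _) _.
      by move=> d; rewrite !inE => /andP[d0 _]; exact: cbad.
    by rewrite leq_mul2r subset_leq_card ?orbT // subsetDl.
  apply: leq_trans (leq_mul (leq_trans h h2) (leqnn N)) _.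
  by rewrite -mulnA leq_mul2l hB orbT.
have p1 : 0 < p.-1 by rewrite -subn1 subn_gt0 prime_gt1.
have : #|[set~ (0%R : 'F_p)]| > #|L|.
  rewrite cardsC1 card_Fp // -(ltn_pmul2r N0); apply: leq_ltn_trans cL _.
  by rewrite mulnC ltn_pmul2l.
case: (boolP [exists l in [set~ (0%R : 'F_p)], l \notin L]) => [|/existsPn h lt].
  move=> /existsP[l /andP[l0 lL]] _; exists l; first by move: l0; rewrite !inE.
  move=> d dD d0; apply: contra lL => dv; apply/bigcupP; exists d.
    by rewrite !inE d0.
  rewrite inE inE dv andbT -[_ == _]/((l * d)%R == 0%R) mulf_neq0 //.
  by move: l0; rewrite !inE.
move: lt; rewrite ltnNge subset_leq_card //; apply/subsetP => l l0.
by have := h l; rewrite l0 /= negbK.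
Qed.

(** Dilate by an [l] for which no nonzero element of 2A - 2A is sent to a multiple of [N], lift to
    [0, p) and reduce modulo [N]. Keeping the more popular half of [0, p) prevents wrapping modulo
    [p]. *)
Lemma ruzsa_model (p N : nat) (A : {set 'F_p}) : prime p ->
  #|sumset (sumset A A) (oppset (sumset A A))| < N ->
  exists (A' : {set 'F_p}) (f : 'F_p -> nat),
    [/\ A' \subset A, #|A| <= 2 * #|A'|, forall x, f x < N &
     {in A' & &, forall x x' y, f x + f x' = f y + f y %[mod N] -> (x + x' = y + y)%R}].
Proof.
move=> pp hN; have N0 : 0 < N by exact: leq_ltn_trans hN.
have [l l0 hl] := dilation_avoiding_multiples pp hN.
have cF : (Zp_trunc (pdiv p)).+2 = p by exact: Fp_cast.
pose rho x : nat := (l * x)%R.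
have rhop x : rho x < p by rewrite -[X in _ < X]cF /rho.
have rhoE x : ((rho x)%:R = l * x)%R by rewrite /rho natr_Zp.
pose H := [set x in A | 2 * rho x < p].
(* The integer rho x + rho x' - 2 rho y lies strictly between -p and p. Up to sign it is thus the
   residue of l d with d in 2A - 2A, and divisibility by [N] forces d = 0. *)
have key (A' : {set 'F_p}) : A' \subset A ->
  {in A' & &, forall x x' y, rho x + rho x' < p + 2 * rho y /\ 2 * rho y < p + rho x + rho x'} ->
  {in A' & &, forall x x' y, rho x %% N + rho x' %% N = rho y %% N + rho y %% N %[mod N] -> (x + x' = y + y)%R}.
  move=> sA hA x x' y xA xA' yA; rewrite !modnDm => e.
  have [lt1 lt2] := hA x x' y xA xA' yA.
  move: (subsetP sA _ xA) (subsetP sA _ xA') (subsetP sA _ yA) => {}xA {}xA' {}yA.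
  have diff (n m : nat) (d : 'F_p) : n = m %[mod N] -> m <= n -> n < p + m ->
    (n%:R - m%:R = l * d)%R -> d \in sumset (sumset A A) (oppset (sumset A A)) -> d = 0%R.
    move=> enm mn ltp ed dD; apply/eqP/negPn/negP => d0.
    have := hl d dD d0; rewrite -ed -natrB //.
    have -> : ((n - m)%:R : 'F_p)%R = n - m :> nat by rewrite val_Fp_nat // modn_small // ltn_subLR // addnC.
    by rewrite -eqn_mod_dvd // enm eqxx.
  case: (leqP (rho y + rho y) (rho x + rho x')) => h.
    apply/eqP; rewrite -subr_eq0; apply/eqP; apply: (diff _ _ _ e) => //; first by rewrite addnn -mul2n.
      by rewrite !natrD !rhoE -!mulrDr -mulrBr.
    by rewrite mem_sumset ?mem_oppset // mem_sumset.
  apply/esym/eqP; rewrite -subr_eq0; apply/eqP; apply: (diff _ _ _ (esym e)) => //.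
- exact: ltnW.
- by rewrite addnn -mul2n addnA.
- by rewrite !natrD !rhoE -!mulrDr -mulrBr.
- by rewrite mem_sumset ?mem_oppset // mem_sumset.
have := cardsID H A; have -> : A :&: H = H by apply/setIidPr/subsetP => x; rewrite inE => /andP[].
move=> cA; case: (leqP #|A :\: H| #|H|) => hc.
  exists H, (fun x => rho x %% N); split; [|by lia|by move=> x; rewrite ltn_mod|].
    by apply/subsetP => x; rewrite inE => /andP[].
  apply: key; first by apply/subsetP => x; rewrite inE => /andP[].
  by move=> x x' y; rewrite !inE => /andP[_ hx] /andP[_ hx'] /andP[_ hy]; lia.
exists (A :\: H), (fun x => rho x %% N); split; [exact: subsetDl|by lia|by move=> x; rewrite ltn_mod|].
apply: key; first exact: subsetDl.
have geH x : x \in A :\: H -> p <= 2 * rho x.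
  by rewrite !inE => /andP[+ xA]; rewrite xA /= -leqNgt.
move=> x x' y /geH hx /geH hx' /geH hy.
by have := rhop x; have := rhop x'; have := rhop y; lia.
Qed.

(** * Density increment *)

Local Open Scope ring_scope.

Lemma sum_prim_root (F : fieldType) (n : nat) (w : F) (i j : nat) :
  n.-primitive_root w -> (i < n)%N -> (j < n)%N ->
  \sum_(k < n) (w ^+ i / w ^+ j) ^+ k = if i == j then n%:R else 0.
Proof.
move=> pw lti ltj; have w0 : w != 0.
  apply: contraTneq (prim_order_gt0 pw) => w0; have := prim_expr_order pw.
  by case: n {pw lti ltj} => // n /eqP; rewrite w0 expr0n /= eq_sym oner_eq0.
have wj : w ^+ j != 0 by rewrite expf_neq0.
case: eqVneq => [->|ij].
  rewrite divff // (eq_bigr (fun _ => 1)) => [|k _]; last exact: expr1n.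
  by rewrite sumr_const card_ord.
apply/eqP; have := subrX1 (w ^+ i / w ^+ j) n.
have e k : (w ^+ k) ^+ n = 1 by rewrite -exprM mulnC exprM (prim_expr_order pw) expr1n.
rewrite expr_div_n !e divr1 subrr.
move/esym/eqP; rewrite mulf_eq0 subr_eq0 => /orP[|//].
rewrite -(inj_eq (mulIf wj)) mul1r divfK // (eq_prim_root_expr pw) !modn_small //.
by rewrite (negbTE ij).
Qed.

(** Fourier analysis modulo 2L, where sums of two numbers below [L] do not wrap. The pair sum is an
    average of [gh k] against squares of [a k], and by Parseval the mean of |a k|^2 is the size of
    [V]. The witness [z] is a power of the primitive root. *)
Lemma fourier_pair_count (L : nat) (V : pred nat) (g : nat -> algC) :
  (0 < L)%N -> exists z : algC, `|z| = 1 /\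
  `|\sum_(x < L | V x) \sum_(y < L | V y) g (x + y)%N| <=
  (\sum_(x < L) V x)%N%:R * `|\sum_(s < 2 * L) g s * z ^+ s|.
Proof.
move=> L0; set W := \sum_(x < L | V x) _; set v := (\sum_(x < L) V x)%N.
have N0 : (0 < 2 * L)%N by lia.
have [w pw] := C_prim_root_exists N0; set N := (2 * L)%N in N0 pw *.
have w0 : w != 0.
  apply: contraTneq N0 => w0; have := prim_expr_order pw.
  by rewrite w0 expr0n; case: (N) => // n /eqP; rewrite /= eq_sym oner_eq0.
have nw : `|w| = 1.
  by apply/eqP; rewrite -(@pexpr_eq1 _ _ N) // -normrX prim_expr_order // normr1.
pose a k := \sum_(x < L | V x) (w ^+ x)^-1 ^+ k.
pose gh k := \sum_(s < N) g s * (w ^+ k) ^+ s.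
have hW : \sum_(k < N) gh k * (a k * a k) = N%:R * W.
  transitivity (\sum_(x < L | V x) \sum_(y < L | V y) \sum_(s < N) g s *
     \sum_(k < N) (w ^+ s / w ^+ (x + y)) ^+ k).
    under eq_bigr => k _.
      rewrite /gh /a mulr_suml.
      under eq_bigr => s _ do (rewrite mulr_suml mulr_sumr; under eq_bigr => x _ do rewrite !mulr_sumr).
      over.
    rewrite exchange_big /=; under eq_bigr => s _ do rewrite exchange_big /=.
    rewrite exchange_big /=; apply: eq_bigr => x _.
    under eq_bigr => s _ do rewrite exchange_big /=.
    rewrite exchange_big /=; apply: eq_bigr => y _; apply: eq_bigr => s _.
    rewrite mulr_sumr; apply: eq_bigr => k _.
    by rewrite -mulrA; congr (_ * _); rewrite exprD invfM !exprMn -!exprM mulnC; ring.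
  rewrite /W mulr_sumr; apply: eq_bigr => x _; rewrite mulr_sumr; apply: eq_bigr => y _.
  have ltxy : (x + y < N)%N by rewrite /N; have := ltn_ord x; have := ltn_ord y; lia.
  rewrite (bigD1 (Ordinal ltxy)) //= sum_prim_root // eqxx big1 ?addr0 => [|s sxy].
    by rewrite mulrC.
  rewrite sum_prim_root // -[_ == _]/(s == Ordinal ltxy :> nat) val_eqE.
  by rewrite (negbTE sxy) mulr0.
have ha : \sum_(k < N) `|a k| ^+ 2 = N%:R * v%:R.
  transitivity (\sum_(x < L | V x) \sum_(y < L | V y)
     \sum_(k < N) (w ^+ y / w ^+ x) ^+ k).
    under eq_bigr => k _ do rewrite normCK /a rmorph_sum /= mulr_suml.
    rewrite exchange_big; apply: eq_bigr => x _ /=.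
    under eq_bigr => k _ do rewrite mulr_sumr.
    rewrite exchange_big; apply: eq_bigr => y _ /=; apply: eq_bigr => k _.
    have -> : (((w ^+ y)^-1 ^+ k)^* = (w ^+ y) ^+ k :> algC).
      have nu : `|(w ^+ y)^-1 ^+ k| = 1 by rewrite normrX normfV normrX nw !(expr1n, invr1).
      by rewrite -[LHS]mul1r -[X in X * _]invr1 -(expr1n _ 2) -nu -invC_norm exprVn invrK.
    by rewrite exprMn mulrC.
  have ltxN (x : 'I_L) : (x < N)%N by rewrite /N; have := ltn_ord x; lia.
  rewrite /v natr_sum mulr_sumr [LHS]big_mkcond; apply: eq_bigr => x _ /=.
  case: ifP => Vx; last by rewrite mulr0.
  rewrite mulr1 (bigD1 x) //= sum_prim_root ?ltxN // eqxx big1 ?addr0 // => y /andP[_ yx].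
  rewrite sum_prim_root ?ltxN //.
  by rewrite -[_ == _]/(val y == val x) val_eqE (negbTE yx).
case: (boolP [exists k : 'I_N, `|W| <= v%:R * `|gh k|]) => [/existsP[k hk]|/existsPn h].
  by exists (w ^+ k); rewrite normrX nw expr1n.
have lt (k : 'I_N) : v%:R * `|gh k| < `|W|.
  by rewrite real_ltNge ?h // ?normr_real // rpredM ?normr_real ?realn.
have [v0|v0] := posnP v.
  exists 1; rewrite normr1; split=> //; suff -> : W = 0 by rewrite normr0 mulr_ge0 ?ler0n.
  rewrite /W big1 // => x Vx; have : (0 < v)%N by rewrite /v (bigD1 x) //= Vx.
  by rewrite v0.
pose k0 : 'I_N := Ordinal N0.
have ak0 : a 0%N = v%:R.
  rewrite /a /v natr_sum [LHS]big_mkcond; apply: eq_bigr => x _ /=.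
  by rewrite expr0; case: ifP.
(* If every coefficient is too small, the triangle inequality and Parseval give a strict inequality
   of a number with itself. Strictness comes from the term k = 0, where [a 0] equals v > 0. *)
suff : N%:R * `|W| * v%:R < N%:R * `|W| * v%:R by rewrite ltxx.
have -> : N%:R * `|W| * v%:R = v%:R * `|\sum_(k < N) gh k * (a k * a k)|.
  by rewrite hW normrM normr_nat; ring.
apply: (@le_lt_trans _ _ (\sum_(k < N) v%:R * `|gh k| * `|a k| ^+ 2)).
  under [leRHS]eq_bigr => k _ do rewrite -mulrA.
  rewrite -mulr_sumr ler_wpM2l ?ler0n //.
  apply: le_trans (ler_norm_sum _ _ _) _; apply: ler_sum => k _.
  by rewrite !normrM expr2.
have -> : v%:R * `|\sum_(k < N) gh k * (a k * a k)| = \sum_(k < N) `|W| * `|a k| ^+ 2.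
  by rewrite -mulr_sumr ha hW normrM normr_nat; ring.
rewrite (bigD1 k0) // [X in _ < X](bigD1 k0) //= ltr_leD //.
  by rewrite ltr_pM2r ?(lt k0) // ak0 normr_nat exprn_gt0 // ltr0n.
by apply: ler_sum => k _; rewrite ler_wpM2r ?exprn_ge0 ?normr_ge0 // ltW.
Qed.

Lemma normC_Im_le (z : algC) : `|'Im z| <= `|z|.
Proof.
rewrite -normrN -ReMil; apply: le_trans (leif_normC_Re_Creal _) _.
by rewrite normrM normCi mul1r.
Qed.

Lemma truncn_eq_dist (x y : algC) : 0 <= x -> 0 <= y -> Num.truncn x = Num.truncn y ->
  `|x - y| <= 1.
Proof.
move=> x0 y0 e; have /andP[hx hx'] := truncn_itv x0; have /andP[hy hy'] := truncn_itv y0.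
rewrite e in hx hx'; rewrite real_ler_norml ?rpredB ?ger0_real //.
rewrite lerBlDl lerBrDl; apply/andP; split.
  by rewrite lerBlDr; apply: le_trans (ltW hy') _; rewrite -natr1 lerD2r.
by apply: le_trans (ltW hx') _; rewrite -natr1 lerD2r.
Qed.

(** Pigeonhole: the square containing the unit circle is cut into (8P + 1)^2 boxes of side 1 / (4P).
    Two powers of [z] in one box differ by at most 1 / (4P) in each coordinate, hence by at most 1 /
    (2P). *)
Lemma dirichlet_circle (z : algC) (P : nat) : (0 < P)%N -> `|z| = 1 ->
  exists2 d, (0 < d <= (8 * P).+1 ^ 2)%N & `|z ^+ d - 1| * (2 * P)%:R <= 1.
Proof.
move=> P0 nz; set D := ((8 * P).+1 ^ 2)%N.
have P4 : 0 <= (4 * P)%:R :> algC by rewrite ler0n.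
have nzj j : `|z ^+ j| = 1 by rewrite normrX nz expr1n.
pose re j := ('Re (z ^+ j) + 1) * (4 * P)%:R; pose im j := ('Im (z ^+ j) + 1) * (4 * P)%:R.
have bnd (x : algC) : x \is Num.real -> `|x| <= 1 -> 0 <= (x + 1) * (4 * P)%:R <= (8 * P)%:R.
  move=> xr; rewrite real_ler_norml // => /andP[h1 h2].
  rewrite mulr_ge0 //=; last by rewrite -lerBlDr sub0r.
  have -> : (8 * P)%:R = (1 + 1) * (4 * P)%:R :> algC by rewrite -[1 + 1]/(2%:R) -natrM mulnA.
  by rewrite ler_wpM2r // lerD2r.
have hre j : 0 <= re j <= (8 * P)%:R.
  by apply: bnd; rewrite ?Creal_Re // -(nzj j) leif_normC_Re_Creal.
have him j : 0 <= im j <= (8 * P)%:R.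
  by apply: bnd; rewrite ?Creal_Im // -(nzj j) normC_Im_le.
have tr x : 0 <= x <= (8 * P)%:R -> (Num.truncn (x : algC) < (8 * P).+1)%N.
  move=> /andP[x0 xP]; rewrite ltnS -(ler_nat algC); apply: le_trans xP.
  by have /andP[] := truncn_itv x0.
pose box (j : 'I_D.+1) : 'I_(8 * P).+1 * 'I_(8 * P).+1 :=
  (Ordinal (tr _ (hre j)), Ordinal (tr _ (him j))).
have /injectivePn[j1 [j2 j12 ej]] : ~~ injectiveb box.
  apply/negP => /injectiveP /leq_card; rewrite card_prod !card_ord /D mulnn.
  by rewrite ltnn.
wlog lt : j1 j2 j12 ej / (j1 < j2)%N => [th|].
  case: (ltngtP j1 j2) => h; [exact: (th j1 j2)|apply: (th j2 j1) => //|].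
    by rewrite eq_sym.
  by case/eqP: j12; apply: val_inj.
exists (j2 - j1)%N; first by have := ltn_ord j2; rewrite subn_gt0 lt /=; lia.
have dist : `|z ^+ j2 - z ^+ j1| = `|z ^+ (j2 - j1) - 1|.
  rewrite -[RHS]mul1r -[X in X * _](nzj j1) -normrM mulrBr mulr1 -exprD.
  by rewrite subnKC // ltnW.
rewrite -dist; move: ej => [er ei].
have /andP[r1 _] := hre j1; have /andP[r2 _] := hre j2.
have /andP[i1 _] := him j1; have /andP[i2 _] := him j2.
have := truncn_eq_dist r2 r1 (esym er); have := truncn_eq_dist i2 i1 (esym ei).
set u := z ^+ j2 - z ^+ j1.
have -> : re j2 - re j1 = 'Re u * (4 * P)%:R by rewrite /re raddfB /=; ring.
have -> : im j2 - im j1 = 'Im u * (4 * P)%:R by rewrite /im raddfB /=; ring.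
rewrite !normrM !normr_nat => hi hr.
have hu : `|u| <= `|'Re u| + `|'Im u|.
  rewrite {1}[u]Crect; apply: le_trans (ler_normD _ _) _.
  by rewrite normrM normCi mul1r.
have : `|u| * (2 * P)%:R * 2%:R <= 2%:R.
  apply: (@le_trans _ _ ((`|'Re u| + `|'Im u|) * (4 * P)%:R)).
    by rewrite -mulrA -natrM (_ : 2 * P * 2 = 4 * P)%N ?ler_wpM2r //; lia.
  by rewrite mulrDl (natrD _ 1 1) lerD.
by rewrite -[X in _ <= X]mul1r ler_pM2r ?ltr0n.
Qed.

(* [f] is extended by zero to the negative integers. *)
Definition shift_sum (f : nat -> int) (d P t : nat) : int :=
  \sum_(j < P) if (j * d <= t)%N then f (t - j * d)%N else 0.

Lemma sum_shift (R : comRingType) (f : nat -> R) (z : R) (L T e : nat) :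
  (forall y, (L <= y)%N -> f y = 0) -> (L + e <= T)%N ->
  \sum_(t < T) (if (e <= t)%N then f (t - e)%N else 0) * z ^+ t =
  z ^+ e * \sum_(y < L) f y * z ^+ y.
Proof.
move=> hf hT; rewrite -(big_mkord xpredT (fun t => (if (e <= t)%N then f (t - e)%N else 0) * z ^+ t)).
rewrite (big_cat_nat (n := e)) //=; last by lia.
rewrite big_nat_cond big1 ?add0r; last by move=> t /andP[/andP[_ lt] _]; rewrite leqNgt lt mul0r.
rewrite -{1}[e]add0n big_addn (big_cat_nat (n := L)) //=; last by lia.
rewrite [X in _ + X]big_nat_cond [X in _ + X]big1 ?addr0; last first.
  by move=> t /andP[/andP[lt _] _]; rewrite leq_addl addnK hf // mul0r.
rewrite big_mkord mulr_sumr; apply: eq_bigr => y _.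
by rewrite leq_addl addnK exprD; ring.
Qed.

(** Convolving [f] with a progression of difference [d] multiplies its transform at [z] by the sum
    of the z^(jd), of modulus at least P / 2 when z^d is close enough to 1. So the shift sums have
    large absolute values on average, and having total 0 they also have a large positive value. *)
Lemma large_shift_sum (L P c : nat) (f : nat -> int) (z : algC) :
  (forall y, (L <= y)%N -> f y = 0) -> \sum_(y < L) f y = 0 ->
  `|z| = 1 -> c%:R <= 2%:R * `|\sum_(y < L) (f y)%:~R * z ^+ y| ->
  (0 < c)%N -> (0 < P)%N -> (P * (8 * P).+1 ^ 2 <= L)%N ->
  exists d t, (0 < d)%N /\ c%:Z * P%:Z <= 16%:Z * L%:Z * shift_sum f d P t.
Proof.
move=> fL f0 nz hc c0 P0 hP; have [d /andP[d0 dD] hd] := dirichlet_circle P0 nz.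
exists d; pose T := (2 * L)%N.
have jdT (j : 'I_P) : (L + j * d <= T)%N.
  have : (j * d <= P * (8 * P).+1 ^ 2)%N by rewrite leq_mul // ltnW.
  by rewrite /T; lia.
have sumz (R : comRingType) (w : R) : \sum_(t < T) (shift_sum f d P t)%:~R * w ^+ t =
    (\sum_(j < P) w ^+ (j * d)) * \sum_(y < L) (f y)%:~R * w ^+ y.
  rewrite mulr_suml; under [LHS]eq_bigr => t _ do rewrite /shift_sum rmorph_sum /= mulr_suml.
  rewrite exchange_big; apply: eq_bigr => j _ /=.
  rewrite -(@sum_shift _ (fun y => (f y)%:~R) w L T) //; last by move=> y /fL ->.
  by apply: eq_bigr => t _; case: ifP.
have F0 : \sum_(t < T) shift_sum f d P t = 0.
  have := sumz int 1; under eq_bigr => t _ do rewrite expr1n mulr1 intz.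
  by move=> ->; under [X in _ * X]eq_bigr => t _ do rewrite expr1n mulr1 intz; rewrite f0 mulr0.
have hz : P%:R <= 2%:R * `|\sum_(j < P) z ^+ (j * d)|.
  have hj (j : 'I_P) : `|z ^+ (j * d) - 1| <= 2^-1.
    have : `|z ^+ (j * d) - 1| <= j%:R * `|z ^+ d - 1|.
      elim: (j : nat) => [|k IH]; first by rewrite mul0n expr0 subrr normr0 mul0r.
      have -> : z ^+ (k.+1 * d) - 1 = (z ^+ (k * d) - 1) + z ^+ (k * d) * (z ^+ d - 1).
        by rewrite mulrBr -exprD mulr1 mulSn addnC; ring.
      apply: le_trans (ler_normD _ _) _.
      by rewrite normrM normrX nz expr1n mul1r -natr1 mulrDl mul1r lerD2r.
    move=> /le_trans; apply; rewrite -(@ler_pM2r _ 2%:R) ?ltr0n // mulVf ?pnatr_eq0 //.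
    apply: le_trans hd; rewrite mulrAC mulrC -natrM ler_wpM2l // ler_nat.
    by rewrite mulnC leq_mul2l ltnW.
  have := ler_norm_sum (index_enum 'I_P) (fun j : 'I_P => 1 - z ^+ (j * d)) xpredT.
  rewrite sumrB sumr_const card_ord => h.
  have h1 : `|P%:R - \sum_(j < P) z ^+ (j * d)| <= P%:R * 2^-1.
    apply: (le_trans h); rewrite -[X in X%:R * _]card_ord -sumr_const mulr_suml; apply: ler_sum => j _.
    by rewrite distrC mul1r.
  have h2 : P%:R <= `|P%:R - \sum_(j < P) z ^+ (j * d)| + `|\sum_(j < P) z ^+ (j * d)| :> algC.
    by rewrite -{1}[P%:R]ger0_norm ?ler0n // -{1}[P%:R](subrK (\sum_(j < P) z ^+ (j * d))) ler_normD.
  have h3 := le_trans h2 (lerD h1 (lexx _)).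
  rewrite -lerBlDl in h3; have -> : P%:R = 2%:R * (P%:R - P%:R * 2^-1) :> algC by field.
  by rewrite ler_wpM2l ?ler0n.
have habs : (c * P)%:Z <= 4%:Z * \sum_(t < T) `|shift_sum f d P t|.
  rewrite -(ler_int algC) -pmulrn natrM intrM rmorph_sum /= -[4%Z%:~R]/(4%:R).
  have : `|\sum_(t < T) (shift_sum f d P t)%:~R * z ^+ t| <= \sum_(t < T) `|shift_sum f d P t|%:~R :> algC.
    apply: le_trans (ler_norm_sum _ _ _) _; apply: ler_sum => t _.
    by rewrite normrM normrX nz expr1n mulr1 intr_norm.
  rewrite sumz normrM => h.
  apply: le_trans (ler_pM (ler0n _ _) (ler0n _ _) hc hz) _.
  rewrite mulrACA [X in _ * X]mulrC -natrM.
  by rewrite ler_wpM2l ?ler0n.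
(* Averaging over |F| + F, twice the positive part of the shift sum F; its total is that of |F|
   because the F sum to 0. *)
have : exists t : 'I_T, (c * P)%:Z <= 4%:Z * (`|shift_sum f d P t| + shift_sum f d P t) * T%:Z.
  case: (boolP [exists t : 'I_T, (c * P)%:Z <= 4%:Z * (`|shift_sum f d P t| + shift_sum f d P t) * T%:Z]).
    by move=> /existsP.
  move=> /existsPn h; exfalso.
  have T0 : (0 < T)%N by rewrite /T; lia.
  have : \sum_(t < T) (4%:Z * (`|shift_sum f d P t| + shift_sum f d P t) * T%:Z + 1) <= \sum_(t < T) (c * P)%:Z.
    by apply: ler_sum => t _; rewrite lezD1 ltNge h.
  rewrite big_split /= -mulr_suml -mulr_sumr big_split /= F0 addr0 !sumr_const card_ord.
  move: habs; move: (\sum_(i < T) _) => s; rewrite -mulr_natl => hs.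
  rewrite -[_ *+ T]mulr_natl natz; nia.
move=> [t ht]; exists t; split=> //; move: ht; rewrite /T; nia.
Qed.

Local Close Scope ring_scope.

(** * Midpoint cliques in dense subsets of an interval *)

Definition midpoint_clique (h : nat) (B : pred nat) :=
  exists s : seq nat, [/\ uniq s, size s = h, all B s &
    {in s &, forall x y, x != y -> exists2 z, B z & x + y = z + z}].

Definition count_below (L : nat) (B : pred nat) := \sum_(y < L) B y.

Lemma count_below_le L B : count_below L B <= L.
Proof.
by rewrite -[X in _ <= X]card_ord -sum1_card; apply: leq_sum => i _; exact: leq_b1.
Qed.

(** Affine maps preserve midpoints; the bound by [t] keeps the truncated subtraction exact. *)
Lemma midpoint_clique_progression (h n t lo d : nat) (B : pred nat) :
  0 < d -> (forall i, i < n -> (lo + i) * d <= t) ->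
  midpoint_clique h (fun i => (i < n) && B (t - (lo + i) * d)) -> midpoint_clique h B.
Proof.
move=> d0 hn [s [us ss /allP aB hs]]; pose f i := t - (lo + i) * d.
have sn i : i \in s -> i < n by move=> /aB /andP[].
have finj : {in s &, injective f}.
  move=> i j /sn/hn hi /sn/hn hj; rewrite /f => e.
  have : (lo + i) * d = (lo + j) * d by lia.
  by move/eqP; rewrite eqn_pmul2r // eqn_add2l => /eqP.
exists (map f s); split; rewrite ?map_inj_in_uniq ?size_map //.
  by apply/allP => _ /mapP[i /aB /andP[_ Bi] ->].
move=> _ _ /mapP[i iS ->] /mapP[j jS ->] fij.
have ij : i != j by apply: contraNneq fij => ->.
have [k /andP[kn Bk] e] := hs i j iS jS ij; exists (f k) => //.
have := hn i (sn i iS); have := hn j (sn j jS); have := hn k kn; rewrite /f.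
have : (lo + i) * d + (lo + j) * d = (lo + k) * d + (lo + k) * d by rewrite -!mulnDl; congr (_ * _); lia.
lia.
Qed.

Lemma sum_double_range (V : nmodType) (F : nat -> V) L :
  (\sum_(s < 2 * L) F s = \sum_(y < L) (F (2 * y)%N + F (2 * y).+1))%R.
Proof.
elim: L => [|L IH]; first by rewrite !big_ord0.
by rewrite mulnS !addSn add0n 2!big_ord_recr /= IH big_ord_recr /= addrA.
Qed.

(** The indices [j] with t - jd in [0, L) form an interval, so a shift sum of the balanced function
    is the excess of [B] over its mean density on one progression. *)
Lemma shift_sum_progression (L b d P t : nat) (B : pred nat) : 0 < d ->
  exists lo n, [/\ n <= P, forall i, i < n -> (lo + i) * d <= t &
   shift_sum (fun y => if (y < L)%N then L%:Z * (B y)%:Z - b%:Z else 0)%R d P t =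
     (L%:Z * (\sum_(i < n) B (t - (lo + i) * d)%N)%:Z - b%:Z * n%:Z)%R].
Proof.
move=> d0; set f := (X in shift_sum X).
(* [lo] is the first index with t - jd < L, and [hi] is cut off by [P] and by t - jd >= 0. *)
pose lo := if t < L then 0 else ((t - L) %/ d).+1.
pose hi := minn P (t %/ d).+1.
have hlo j : (j < lo) = (L <= t - j * d) && (j * d <= t).
  rewrite /lo; case: (ltnP t L) => tL.
    by rewrite ltn0; apply/esym/negP => /andP[]; move: (j * d) => k; lia.
  rewrite ltnS leq_divRL //; move: (j * d) => k.
  by apply/idP/andP => [|[]]; lia.
have hhi j : (j < hi) = (j < P) && (j * d <= t) by rewrite ltn_min ltnS leq_divRL.
have hiP : hi <= P by exact: geq_minl.
pose G j : int := if (j * d <= t)%N then f (t - j * d)%N else 0%R.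
have -> : shift_sum f d P t = (\sum_(lo <= j < hi) G j)%R.
  rewrite /shift_sum -(big_mkord xpredT G).
  have [lohi|hilo] := leqP lo hi.
    rewrite (big_cat_nat (n := hi)) //= (big_cat_nat (n := lo)) //=.
    rewrite [X in (X + _ + _)%R]big_nat_cond [X in (X + _ + _)%R]big1 => [|j /andP[/andP[_ h] _]].
      rewrite [X in (_ + X)%R]big_nat_cond [X in (_ + X)%R]big1 => [|j /andP[/andP[h1 h2] _]].
        by rewrite add0r addr0.
      by rewrite /G ifN //; move: h1; rewrite leqNgt hhi h2.
    by move: h; rewrite hlo /G /f => /andP[h ->]; rewrite ltnNge h.
  rewrite [RHS]big_geq; last exact: ltnW.
  rewrite big_nat_cond big1 // => j /andP[/andP[_ jP] _]; rewrite /G; case: ifP => // jt.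
  have : j < lo by apply: leq_trans hilo; rewrite ltnS ltnW // hhi jP.
  by rewrite hlo /f => /andP[h _]; rewrite ltnNge h.
exists lo, (hi - lo); split; first by lia.
  by move=> i ilt; have : lo + i < hi by [lia]; rewrite hhi => /andP[].
rewrite -{1}[lo]add0n big_addn big_mkord.
rewrite (eq_bigr (fun i : 'I_(hi - lo) => L%:Z * (B (t - (lo + i) * d)%N)%:Z - b%:Z)%R); last first.
  move=> i _; rewrite /G /f [i + lo]addnC.
  have ilt : lo + i < hi by have := ltn_ord i; lia.
  have := hhi (lo + i); rewrite ilt => /esym/andP[_ ht]; rewrite ht.
  have := hlo (lo + i); rewrite ltnNge leq_addr ht andbT leqNgt => /esym/negbFE ->.
  by [].
rewrite sumrB -mulr_sumr sumr_const card_ord -mulr_natr natz; congr (_ * _ - _)%R.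
by rewrite -natz natr_sum; apply: eq_bigr => i _; rewrite natz.
Qed.

(** If [V] has at most half the expected number of midpoints in [B], the balanced function f = L 1_B
    - b has a pair sum of modulus at least b v^2 / 2. Sums of two elements of [V] are even, so [g]
    places [f] on the even numbers; a large coefficient of [g] at [z] is one of [f] at z^2, and
    yields a progression on which [B] is denser. *)
Lemma density_increment (L P : nat) (o : bool) (B V : pred nat) :
  let b := count_below L B in let v := count_below L V in
  (forall y, B y -> y < L) -> (forall x, V x -> x < L) -> (forall x, V x -> odd x = o) ->
  2 * L * (\sum_(x < L | V x) \sum_(y < L | V y) B ((x + y)./2)) <= b * v ^ 2 ->
  0 < b -> 0 < v -> 0 < P -> P * (8 * P).+1 ^ 2 <= L ->
  exists n (B' : pred nat), [/\ n <= P, forall y, B' y -> y < n,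
    forall h, midpoint_clique h B' -> midpoint_clique h B &
    b * v * P + 16 * L * n * b <= 16 * L * L * count_below n B'].
Proof.
move=> b v BL VL Vo he b0 v0 P0 hP; set e := \sum_(x < L | V x) _ in he.
have L0 : 0 < L by apply: leq_trans hP; rewrite muln_gt0 P0 expn_gt0.
pose f y : int := (if (y < L)%N then L%:Z * (B y)%:Z - b%:Z else 0)%R.
pose g s : algC := (if odd s then 0 else (f s./2)%:~R)%R.
have [z [nz hz]] := fourier_pair_count V g L0.
have fL y : L <= y -> f y = 0%R by rewrite /f ltnNge => ->.
have f0 : (\sum_(y < L) f y = 0)%R.
  rewrite (eq_bigr (fun y : 'I_L => L%:Z * (B y)%:Z - b%:Z)%R); last by move=> y _; rewrite /f ltn_ord.
  rewrite sumrB -mulr_sumr sumr_const card_ord -mulr_natl natz.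
  suff -> : (\sum_(y < L) (B y)%:Z = b%:Z)%R by rewrite subrr.
  by rewrite -natz natr_sum; apply: eq_bigr => i _; rewrite natz.
have sumg : (\sum_(s < 2 * L) g s * z ^+ s = \sum_(y < L) (f y)%:~R * (z ^+ 2) ^+ y)%R.
  rewrite (sum_double_range (fun s => g s * z ^+ s)%R); apply: eq_bigr => y _.
  by rewrite /g /= mul2n odd_double /= mul0r addr0 doubleK -exprM mul2n.
have W : (\sum_(x < L | V x) \sum_(y < L | V y) g (x + y)%N = (L%:Z * e%:Z - b%:Z * (v%:Z * v%:Z))%:~R :> algC)%R.
  have V2 x y : V x -> V y -> ((x + y)./2 < L) && ~~ odd (x + y).
    move=> Vx Vy; rewrite oddD (Vo x) // (Vo y) // addbb andbT.
    by have := VL x Vx; have := VL y Vy; lia.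
  transitivity (\sum_(x < L | V x) \sum_(y < L | V y) (L%:R * (B ((x + y)./2))%:R - b%:R : algC))%R.
    apply: eq_bigr => x Vx; apply: eq_bigr => y Vy; rewrite /g.
    have /andP[lt /negbTE ->] := V2 x y Vx Vy.
    by rewrite /f lt rmorphB rmorphM /= -!pmulrn.
  have cst (c : algC) : (\sum_(y < L | V y) c = v%:R * c)%R.
    rewrite /v /count_below natr_sum mulr_suml big_mkcond; apply: eq_bigr => i _.
    by case: (V i); rewrite ?mul1r ?mul0r.
  under eq_bigr => x Vx do rewrite sumrB -mulr_sumr -natr_sum cst.
  rewrite sumrB -mulr_sumr -natr_sum -/e cst rmorphB !rmorphM /= -!pmulrn.
  by rewrite [(b%:R * _)%R]mulrC mulrA.
have hc : ((b * v)%:R <= 2%:R * `|\sum_(y < L) (f y)%:~R * (z ^+ 2) ^+ y| :> algC)%R.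
  rewrite -(@ler_pM2l _ v%:R) ?ltr0n // mulrCA -sumg.
  apply: le_trans (_ : _ <= 2%:R * `|(L%:Z * e%:Z - b%:Z * (v%:Z * v%:Z))%:~R|)%R _; last first.
    by rewrite -W ler_wpM2l ?ler0n.
  rewrite -intr_norm -[2%:R%R]/(2%:~R)%R -natrM -intrM pmulrn ler_int.
  by move: he; clear; nia.
have nz2 : (`|z ^+ 2| = 1)%R by rewrite normrX nz expr1n.
have bv0 : 0 < b * v by rewrite muln_gt0 b0.
have [d [t [d0 ht]]] := large_shift_sum fL f0 nz2 hc bv0 P0 hP.
have [lo [n [nP hn hF]]] := shift_sum_progression L b P t B d0.
exists n, (fun i => (i < n) && B (t - (lo + i) * d)); split=> //.
- by move=> y /andP[].
- by move=> h; exact: midpoint_clique_progression.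
have -> : count_below n (fun i => (i < n) && B (t - (lo + i) * d)) = \sum_(i < n) B (t - (lo + i) * d).
  by apply: eq_bigr => i _; rewrite ltn_ord.
by move: ht; rewrite -/f hF; move: (\sum_(i < n) _); clear; nia.
Qed.

Definition midpoint_pairs (L : nat) (B V : pred nat) :=
  \sum_(x < L | V x) \sum_(y < L | V y) B ((x + y)./2).

(** Greedy choice. If [V] is not sparse, some [x] in [V] has midpoints in [B] with at least a 1 /
    (2q) proportion of [V]; pass to these neighbours and repeat. Here 1 / r is the current density
    of [V], and each of the [k] rounds costs a factor 4q. *)
Lemma midpoint_clique_or_sparse (L q R k r : nat) (o : bool) (B V : pred nat) :
  let b := count_below L B in
  0 < L -> L <= q * b -> 4 * q * R <= L -> r * (4 * q) ^ k <= R ->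
  (forall x, V x -> [&& x < L, B x & odd x == o]) -> L <= count_below L V * r ->
  midpoint_clique k B \/
  exists V' : pred nat, [/\ forall x, V' x -> [&& x < L, B x & odd x == o],
    L <= count_below L V' * R &
    2 * L * midpoint_pairs L B V' <= b * count_below L V' ^ 2].
Proof.
move=> b L0 qb RL.
have q0 : 0 < q by case: (q) qb => //; rewrite mul0n leqNgt L0.
(* The induction needs the clique inside [V], not merely inside [B], so that the vertices found
   later are all joined to the earlier ones. *)
suff main : r * (4 * q) ^ k <= R ->
  (forall x, V x -> [&& x < L, B x & odd x == o]) -> L <= count_below L V * r ->
  (exists s : seq nat, [/\ uniq s, size s = k, all V s &
    {in s &, forall x y, x != y -> exists2 z, B z & x + y = z + z}]) \/
  exists V' : pred nat, [/\ forall x, V' x -> [&& x < L, B x & odd x == o],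
    L <= count_below L V' * R &
    2 * L * midpoint_pairs L B V' <= b * count_below L V' ^ 2].
  move=> h1 h2 h3; case: (main h1 h2 h3) => [[s [us ss /allP aV hs]]|]; [left|by right].
  by exists s; split=> //; apply/allP => x /aV /h2 /and3P[].
elim: k r V => [|k IH] r V rR VB rL; first by left; exists [::].
set v := count_below L V in rL.
have rR' : r <= R by apply: leq_trans rR; rewrite leq_pmulr // expn_gt0 muln_gt0 q0.
case: (leqP (2 * L * midpoint_pairs L B V) (b * v ^ 2)) => [hV|hV].
  by right; exists V; split=> //; apply: leq_trans rL _; rewrite leq_mul2l rR' orbT.
have r0 : 0 < r by case: (r) rL => //; rewrite muln0 leqNgt L0.
have v4 : 4 * q <= v.
  rewrite -(leq_pmul2r r0); apply: leq_trans rL; apply: leq_trans RL.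
  by rewrite leq_mul2l rR' orbT.
pose deg x := \sum_(y < L | V y) B ((x + y)./2).
have [x Vx hx] : exists2 x : 'I_L, V x & b * v < 2 * L * deg x.
  case: (boolP [exists x : 'I_L, V x && (b * v < 2 * L * deg x)]) => [/existsP[x /andP[]]|].
    by exists x.
  move=> /existsPn h; move: hV; rewrite ltnNge => /negP[].
  rewrite /midpoint_pairs big_distrr /= expnS expn1 mulnA [b * v * v]mulnC.
  rewrite {1}/v /count_below big_distrl big_mkcond /=; apply: leq_sum => x _.
  by have := h x; case: (V x) => //=; rewrite mul1n -leqNgt.
(* Excluding [x] keeps the chosen points distinct; the loss of one point is absorbed by 4q <= v,
   turning 2q into 4q. *)
pose V' := fun y : nat => [&& V y, B ((x + y)./2) & y != x :> nat].
have hdeg : deg x <= (count_below L V').+1.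
  rewrite /deg (bigID (fun y : 'I_L => y == x)) /= -[in X in _ <= X]add1n leq_add //.
    rewrite (big_pred1 x) ?leq_b1 // => y /=; case: eqP => [->|_]; rewrite ?andbF //.
    by rewrite Vx.
  rewrite big_mkcond; apply: leq_sum => y _; rewrite /V' -[y == x]/(val y == val x) /=.
  by case: (V y) => //; case: (_ != _) => //; rewrite ?andbT // leq_b1.
have hv' : v <= 4 * q * count_below L V'.
  have h1 : v <= 2 * q * deg x.
    rewrite -(leq_pmul2l L0); apply: leq_trans (leq_mul qb (leqnn v)) _.
    by rewrite -mulnA; move: (ltnW hx); move: (deg x) => g; clear; nia.
  move: h1 hdeg v4; move: (deg x) (v) (count_below _ _) => g w c; clear; nia.
have V'V y : V' y -> V y by case/and3P.
case: (IH (4 * q * r) V').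
- by apply: leq_trans rR; rewrite expnS; lia.
- by move=> y /V'V /VB.
- by apply: leq_trans rL (leq_trans (leq_mul hv' (leqnn r)) _); lia.
- move=> [s [us ss /allP aV hs]]; left; exists (val x :: s); split=> /=.
  + rewrite us andbT; apply/negP => /aV; by rewrite /V' eqxx !andbF.
  + by rewrite ss.
  + by rewrite Vx; apply/allP => y /aV /V'V.
  have nb y : y \in s -> exists2 z, B z & x + y = z + z.
    move=> /aV /and3P[Vy By _]; exists ((x + y)./2) => //.
    have /and3P[_ _ /eqP ox] := VB _ Vx; have /and3P[_ _ /eqP oy] := VB _ Vy.
    by rewrite addnn halfK oddD ox oy addbb subn0.
  move=> y z /predU1P[->|ys] /predU1P[->|zs]; rewrite ?eqxx //; first by move=> _; exact: nb.
    by rewrite addnC => _; exact: nb.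
  exact: hs.
by right.
Qed.

(** Length sufficient for [k] further increments: a step with parameter P needs P (8P + 1)^2 <= 81
    P^3 and may shrink the interval to length P / Q. *)
Fixpoint increment_bound (Q k : nat) : nat :=
  if k is k'.+1 then 81 * (Q * increment_bound Q k') ^ 3 else 81 * Q.

Lemma increment_bound_ge Q k : Q <= increment_bound Q k.
Proof.
elim: k => [|k IH] /=; first by lia.
case: (posnP Q) => [-> //|Q0]; have : 0 < Q * increment_bound Q k.
  by rewrite muln_gt0 Q0 (leq_trans Q0).
have : Q <= Q * increment_bound Q k by rewrite leq_pmulr // (leq_trans Q0).
move: (Q * _) => m; rewrite !expnS expn0; clear; nia.
Qed.

(** Induction on [k], where the density of [B] is at least 1 - k / Q. Without a clique, the density
    on some progression is larger by at least 1 / Q; at k = 0 it would exceed 1. *)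
Lemma dense_midpoint_clique (h q : nat) : 0 < q ->
  let R := 2 * q * (4 * q) ^ h in let Q := 16 * q * R in
  forall k L (B : pred nat), (forall y, B y -> y < L) ->
  L <= q * count_below L B -> Q * L <= Q * count_below L B + k * L ->
  increment_bound Q k <= L -> midpoint_clique h B.
Proof.
move=> q0 R Q.
have R0 : 0 < R by rewrite !muln_gt0 expn_gt0 q0 muln_gt0 q0.
have Q0 : 0 < Q by rewrite /Q muln_gt0 R0 muln_gt0 q0.
have step P L (B : pred nat) : (forall y, B y -> y < L) -> L <= q * count_below L B ->
    0 < P -> P * (8 * P).+1 ^ 2 <= L -> Q <= L -> midpoint_clique h B \/
    exists n (B' : pred nat), [/\ n <= P, forall y, B' y -> y < n,
    midpoint_clique h B' -> midpoint_clique h B &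
    L * P + Q * n * count_below L B <= Q * L * count_below n B'].
  move=> BL qb P0 hP QL; have L0 : 0 < L := leq_trans Q0 QL; set b := count_below L B in qb *.
  have b0 : 0 < b by case: (posnP b) qb => // ->; rewrite muln0 leqNgt L0.
  (* The larger parity class of [B] has density at least 1 / (2q), which accounts for the factor 2q
     in [R]. *)
  pose V o x := B x && (odd x == o).
  have Vb : b = count_below L (V true) + count_below L (V false).
    rewrite -big_split; apply: eq_bigr => y _ /=; rewrite /V.
    by case: (B y); case: (odd y).
  have [o ho] : exists o, b <= 2 * count_below L (V o).
    by case: (leqP (count_below L (V true)) (count_below L (V false))) => hc;
      [exists false|exists true]; rewrite Vb; lia.
  have VV x : V o x -> [&& x < L, B x & odd x == o] by move=> /andP[/[dup] /BL -> -> ->].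
  have h1 : 4 * q * R <= L by apply: leq_trans QL; rewrite /Q -!mulnA leq_mul2r orbT.
  have h2 : L <= count_below L (V o) * (2 * q).
    by apply: leq_trans qb _; rewrite mulnC (leq_trans (leq_mul ho (leqnn q))) //; lia.
  have := midpoint_clique_or_sparse L0 qb h1 (leqnn R) VV h2.
  move=> [|[V' [V'V vR sp]]]; [by left|right].
  set v := count_below L V' in vR sp.
  have v0 : 0 < v by case: (posnP v) vR => // ->; rewrite mul0n leqNgt L0.
  have [n [B' [nP B'n pb hb]]] := @density_increment L P o B V' BL
    (fun x Vx => (fun H => let: And3 H _ _ := H in H) (and3P (V'V x Vx)))
    (fun x Vx => (fun H => let: And3 _ _ H := H in eqP H) (and3P (V'V x Vx))) sp b0 v0 P0 hP.
  exists n, B'; split=> //; first exact: pb.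
  (* From b >= L / q and v >= L / R, the gain b v P / (16 L^2) is at least P / Q. *)
  rewrite -(leq_pmul2l L0); have h3 := leq_mul (leq_mul qb vR) (leqnn P).
  have h4 := leq_mul (leqnn (q * R)) hb.
  apply: leq_trans (_ : _ <= q * b * (v * R) * P + L * (Q * n * b)) _.
    by rewrite mulnDr leq_add2r mulnA.
  by move: h4; rewrite /Q -/b; lia.
elim=> [|k IH] L B BL qb Qb FL.
all: have QL := leq_trans (increment_bound_ge Q _) FL.
all: have L0 : 0 < L := leq_trans Q0 QL.
  have L81 : 1 * (8 * 1).+1 ^ 2 <= L by apply: leq_trans FL; rewrite /= leq_pmulr.
  case: (step 1 L B BL qb isT L81 QL) => // -[n [B' [n1 B'n _ hb]]].
  have := count_below_le n B'; move: hb Qb; rewrite mul0n addn0.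
  by move: (count_below L B) (count_below n B') => b b' h1 h2 h3; nia.
set P := Q * increment_bound Q k; rewrite /= -/P in FL.
have P0 : 0 < P by rewrite muln_gt0 Q0 (leq_trans Q0) ?increment_bound_ge.
have hP : P * (8 * P).+1 ^ 2 <= L by apply: leq_trans FL; rewrite !expnS expn0; nia.
case: (step P L B BL qb P0 hP QL) => // -[n [B' [nP B'n pb hb]]].
have b'n := count_below_le n B'; apply: pb.
move: hb Qb b'n; set b := count_below L B; set b' := count_below n B' => hb Qb b'n.
have nb : n * b <= L * b'.
  rewrite -(leq_pmul2l Q0) !mulnA; apply: leq_trans hb; exact: leq_addl.
apply: IH B'n _ _ _; rewrite -/b'.
- by rewrite -(leq_pmul2l L0); move: qb nb; rewrite -/b; clear; nia.
- rewrite -(leq_pmul2l L0); have := leq_mul (leqnn n) Qb; have := leq_mul (leqnn L) nP.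
  by move: hb; clear; lia.
(* Since b' <= n, this shows that the new interval is long enough for the remaining increments. *)
have : P <= Q * b'.
  rewrite -(leq_pmul2l L0); apply: leq_trans (leq_trans hb _); first exact: leq_addr.
  by rewrite mulnCA mulnA.
by rewrite /P leq_pmul2l // => /leq_trans; apply.
Qed.

(** * Independent sets in the sum graph *)

Lemma increment_bound_le Q k : increment_bound Q k <= (81 * Q) ^ (6 ^ k).
Proof.
elim: k => [|k IH] /=; first by rewrite expn0 expn1.
case: (posnP Q) => [->|Q0]; first by rewrite mul0n.
have Q81 : 0 < 81 * Q by rewrite muln_gt0.
apply: (@leq_trans ((81 * Q) ^ 3 * ((81 * Q) ^ (6 ^ k)) ^ 3)).
  rewrite expnMn mulnA leq_mul ?leq_exp2r // expnMn leq_mul2r; apply/orP; right.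
  by [].
rewrite -expnM -expnD leq_pexp2l // expnS; have : 0 < 6 ^ k by rewrite expn_gt0.
by move: (6 ^ k); lia.
Qed.

(* [h ^ 33] bounds the doubling constant and [(h ^ 33) ^ 4] the size of the double
   difference set; the model then loses at most a factor 4. *)
Definition density_const h := 4 * (h ^ 33) ^ 4.
Definition clique_const h :=
  16 * density_const h * (2 * density_const h * (4 * density_const h) ^ h).

(** Writing Q for [clique_const h], the left side is at most 2^(2^(4Q)), because [increment_bound]
    is doubly exponential in Q; and 4Q <= h^(152h) <= 2^(h^4). *)
Lemma size_bound h : 16 <= h ->
  h ^ 7 * increment_bound (clique_const h) (clique_const h) <= 2 ^ 2 ^ 2 ^ (h ^ 4).
Proof.
move=> h16; have h0 : 0 < h by exact: leq_trans h16.
have hE k : 16 ^ k <= h ^ k by case: k => // k; rewrite leq_exp2r.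
have hM a b i j : a <= h ^ i -> b <= h ^ j -> a * b <= h ^ (i + j).
  by move=> ai bj; rewrite expnD leq_mul.
have h1 : h <= h ^ 1 by rewrite expn1.
have h2 c : c <= 16 -> c <= h ^ 1 by move=> c16; rewrite expn1 (leq_trans c16).
have hX a i k : a <= h ^ i -> a ^ k <= h ^ (i * k).
  by move=> ai; rewrite expnM; case: k => // k; rewrite leq_exp2r.
set K := h ^ 33; set q := density_const h; set Q := clique_const h.
have q133 : q <= h ^ 133 by apply: (hM _ _ 1 132 (h2 4 _)) => //; rewrite -expnM.
have q4 : 4 * q <= h ^ 134 by exact: (hM _ _ 1 133 (h2 4 _)).
have q2 : 2 * q <= h ^ 134 by apply: leq_trans q4; rewrite leq_mul2r orbT.
have Q4 : 4 * Q <= h ^ (152 * h).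
  apply: (@leq_trans (h ^ (1 + (1 + 133 + (134 + 134 * h))))).
    by apply: (hM _ _ _ _ (h2 4 _)) => //; apply: (hM _ _ _ _); [apply: (hM _ _ _ _) => //; exact: h2|apply: (hM _ _ _ _) => //; exact: hX].
  by apply: leq_pexp2l => //; move: h16; clear; lia.
have Q2 : 4 * Q <= 2 ^ (h ^ 4).
  apply: leq_trans Q4 _; apply: (@leq_trans ((2 ^ h) ^ (152 * h))).
    by rewrite leq_exp2r ?muln_gt0 ?h0 // ltnW // ltn_expl.
  have h4 : h * (152 * h) <= h ^ 4.
    rewrite mulnCA (_ : 4 = 2 + 2) // expnD mulnn leq_mul2r; apply/orP; right.
    by apply: leq_trans (hE 2).
  by rewrite -expnM; apply: leq_pexp2l h4.
have K0 : h ^ 7 <= K by apply: leq_pexp2l.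
have h70 : 0 < h ^ 7 by rewrite expn_gt0 h0.
have KQ : K <= Q.
  have Kp : 0 < K by exact: leq_trans K0.
  have Kq : K <= q by rewrite /q /density_const (leq_trans (_ : _ <= K ^ 4)) ?leq_pmull // -{1}[K]expn1 leq_pexp2l.
  apply: (leq_trans Kq); rewrite /Q /clique_const -/q.
  have qp : 0 < q by exact: leq_trans Kq.
  rewrite -mulnA mulnCA; apply: leq_pmulr.
  by rewrite muln_gt0 (muln_gt0 (2 * q)) (muln_gt0 2) expn_gt0 (muln_gt0 4) qp.
have Qbig : h ^ 7 <= Q := leq_trans K0 KQ.
have Q10 : 10 <= Q by apply: leq_trans Qbig; apply: leq_trans (_ : 16 <= _) => //; apply: leq_trans h16 _; rewrite -{1}[h]expn1 leq_pexp2l.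
have p81 n : 10 <= n -> 81 * n <= 2 ^ n.
  move=> /subnK <-; elim: (n - 10) => // d IH; rewrite addSn expnS.
  by move: IH; move: (2 ^ _) => e; clear; lia.
have T1 : increment_bound Q Q <= (2 ^ Q) ^ (6 ^ Q).
  apply: leq_trans (increment_bound_le _ _) _; rewrite leq_exp2r ?expn_gt0 //; exact: p81.
apply: (@leq_trans (2 ^ Q * (2 ^ Q) ^ (6 ^ Q))).
  by rewrite leq_mul // (leq_trans Qbig) // ltnW // ltn_expl.
rewrite -expnM -expnD leq_pexp2l // -[X in X + _]muln1 -mulnDr.
apply: (@leq_trans (2 ^ Q * 8 ^ Q)).
  rewrite leq_mul //; first by rewrite ltnW // ltn_expl.
  by rewrite add1n ltn_exp2r // (leq_trans _ Q10).
by rewrite (_ : 8 = 2 ^ 3) // -expnM -expnD leq_pexp2l.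
Qed.

Lemma clique_const_gt0 h : 0 < h -> 0 < clique_const h.
Proof. by move=> h0; rewrite /clique_const /density_const !(muln_gt0, expn_gt0) h0. Qed.

Lemma val_addFp p (x y : 'F_p) : prime p -> x + y < p -> (x + y)%R = x + y :> nat.
Proof. by move=> pp lt; rewrite /= modn_small // [X in _ < X]Fp_cast. Qed.

(** The combinatorial core, placed in 'F_p so that the group results apply; 4x < p makes sums of two
    elements agree with sums of integers. *)
Lemma sum_avoiding_subset (p h : nat) (X Y : {set 'F_p}) :
  prime p -> 16 <= h ->
  (forall x : 'F_p, x \in X :|: Y -> 0 < x /\ 4 * x < p) ->
  #|X| * h ^ 29 <= #|Y| ->
  h ^ 7 * increment_bound (clique_const h) (clique_const h) <= #|Y| ->
  exists Z : {set 'F_p}, [/\ Z \subset Y :\: X, #|Z| = h &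
    {in Z &, forall x y : 'F_p, x != y -> ~~ [exists s in X :|: Y, val s == x + y]}].
Proof.
move=> pp h16 small XY large; pose S := X :|: Y.
pose inS (n : nat) := [exists s in S, val s == n].
case: (boolP [exists Z : {set 'F_p}, [&& Z \subset Y :\: X, #|Z| == h &
   [forall x in Z, forall y in Z, (x != y) ==> ~~ inS (x + y)]]]).
  move=> /existsP[Z /and3P[ZY /eqP Zh /forall_inP ZS]]; exists Z; split=> // x y xZ yZ xy.
  by have /forall_inP/(_ y yZ)/implyP/(_ xy) := ZS x xZ.
move=> /existsPn noZ; exfalso.
have indep (V : {set 'F_p}) (r : rel 'F_p) : V \subset Y :\: X ->
    (forall x y : 'F_p, x \in V -> y \in V -> inS (x + y) -> r x y) ->
    forall Z : {set 'F_p}, Z \subset V -> {in Z &, forall x y, r x y -> x = y} -> #|Z| <= h.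
  move=> VY hr Z ZV Zi; rewrite leqNgt; apply/negP => /ltnW hZ; have [Z' Z'Z cZ'] : exists2 Z' : {set 'F_p}, Z' \subset Z & #|Z'| = h.
    have /card_geqP[s [us ss sZ]] := hZ; exists [set x in s].
      by apply/subsetP => x; rewrite inE => /sZ.
    by rewrite cardsE (card_uniqP us).
  have Z'V := subset_trans Z'Z ZV.
  have /negP[] := noZ Z'; rewrite (subset_trans Z'V VY) cZ' eqxx /=.
  apply/forall_inP => x xZ; apply/forall_inP => y yZ; apply/implyP => /eqP xy.
  apply/negP => /hr h1; apply: xy; apply: Zi; rewrite ?(subsetP Z'Z) //.
  by apply: h1; rewrite (subsetP Z'V).
have h0 : 0 < h by exact: leq_trans h16.
(* Below, |Y| <= 2592 h^2 |D|, so this inequality makes [X] at most half as large as [D]. *)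
have h29 : 2 * 2592 * h ^ 2 <= h ^ 29.
  have -> : h ^ 29 = h ^ 27 * h ^ 2 by rewrite -expnD.
  rewrite leq_mul2r; apply/orP; right.
  by apply: (@leq_trans (16 ^ 4)) => //; rewrite (leq_trans (_ : _ <= h ^ 4)) // ?leq_exp2r // leq_pexp2l.
pose U := Y :\: X; set n := #|U|.
have Ypos : 0 < #|Y|.
  apply: leq_trans large; rewrite muln_gt0 expn_gt0 h0 /=.
  exact: leq_trans (clique_const_gt0 h0) (increment_bound_ge _ _).
have Yn : #|Y| <= n + #|X| by rewrite -(cardsID X Y) addnC leq_add2l subset_leq_card ?subsetIr.
have X2 : 2 * #|X| <= #|Y|.
  have h2 : 0 < h ^ 2 by rewrite expn_gt0 h0.
  apply: leq_trans XY; rewrite mulnC leq_mul2l; apply/orP; right.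
  by apply: leq_trans h29; move: h2; clear; lia.
have Y2n : #|Y| <= 2 * n by move: Yn X2; clear; lia.
have n0 : 0 < n by move: Y2n Ypos; clear; lia.
have s4n : #|S| <= 4 * n.
  by apply: leq_trans (leq_card_setU X Y) _; move: X2 Y2n; clear; lia.
have US x : x \in U -> x \in S by rewrite !inE => /andP[_ ->]; rewrite orbT.
pose r (x y : 'F_p) := (x == y) || inS (x + y).
have rrefl : reflexive r by move=> x; rewrite /r eqxx.
have rsym : symmetric r by move=> x y; rewrite /r eq_sym addnC.
have Uturan := turan_independence rrefl rsym
  (indep U r (subxx _) (fun x y _ _ hs => introT orP (or_intror hs))).
have [v hv] := large_valuation_class (fun x xU => proj1 (small x (US x xU))) (fun x y h => h) Uturan.
set V := [set x in U | _] in hv; set m := #|V| in hv.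
(* The 9 is 1 + 2 * 4, from |U| + 2|S| and |S| <= 4n. *)
have nm : n <= 9 * h * m.
  have : n * n <= n * (9 * h * m).
    rewrite mulnn; apply: leq_trans hv _; rewrite -/n.
    apply: (@leq_trans (h * (9 * n) * m)); last by lia.
    by rewrite leq_mul2r leq_mul2l; apply/orP; right; apply/orP; right; move: s4n; clear; lia.
  by rewrite leq_pmul2l.
have VU : V \subset U by apply/subsetP => x; rewrite inE => /andP[].
have V2 x : x \in V -> 0 < x /\ logn 2 x = v.
  by rewrite inE => /andP[/US/small[x0 _] /eqP].
have [k hk] := doubling_exit V2 (subset_trans VU (introT subsetP US)).
set D := [set x in V | _] in hk.
have sm : #|S| <= 36 * h * m by move: s4n nm; clear; nia.
have m0 : 0 < m by case: (posnP m) nm => // ->; rewrite muln0; move: n0; clear; lia.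
have mD : m <= 144 * h * #|D|.
  have : m * m <= m * (144 * h * #|D|) by apply: leq_trans hk _; move: sm; clear; nia.
  by rewrite leq_pmul2l.
(* Dilation by 2^k brings [D] to its last position inside [S], so doubling once more leaves [S].
   Discarding [X] puts the result inside Y \ X. *)
pose A : {set 'F_p} := [set ((2 ^ k)%:R * x)%R | x in D] :\: X.
have valD x : x \in D -> ((2 ^ k)%:R * x)%R = 2 ^ k * x :> nat.
  rewrite inE => /andP[_ /andP[/existsP[s /andP[_ /eqP es]] _]].
  rewrite -[x in LHS]natr_Zp -natrM val_Fp_nat // modn_small // -es.
  by apply: leq_trans (ltn_ord s) _; rewrite Fp_cast.
have inSE (x : 'F_p) : inS x -> x \in S.
  by move=> /existsP[s /andP[sS /eqP/val_inj <-]].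
have AY : A \subset Y :\: X.
  apply/subsetP => _ /setDP[/imsetP[x xD ->] nX].
  have : ((2 ^ k)%:R * x)%R \in S.
    by apply: inSE; rewrite valD //; move: xD; rewrite inE => /andP[_ /andP[]].
  by rewrite in_setU in_setD (negbTE nX).
have Adbl x : x \in A -> ~~ inS (x + x).
  move=> /setDP[/imsetP[y yD ->] _]; rewrite !valD // addnn -mul2n mulnA -expnS.
  by move: yD; rewrite inE => /andP[_ /andP[_]].
have nD : n <= 1296 * h ^ 2 * #|D| by move: nm mD; clear; nia.
have DA : #|D| <= 2 * #|A|.
  pose D2 := [set ((2 ^ k)%:R * x)%R | x in D].
  have cD2 : #|D2| = #|D|.
    rewrite card_in_imset // => x y xD yD e; apply: val_inj; apply/eqP.
    by rewrite -(@eqn_pmul2l (2 ^ k)) ?expn_gt0 // -(valD x xD) -(valD y yD) e.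
  have DX : #|D| <= #|A| + #|X|.
    by rewrite -cD2 -(cardsID X D2) addnC leq_add2l subset_leq_card ?subsetIr.
  have XD : 2 * #|X| <= #|D|.
    have h2 : 0 < h ^ 2 by rewrite expn_gt0 h0.
    have := leq_mul (leqnn #|X|) h29; move: XY Y2n nD h2.
    by move: (h ^ 29) (h ^ 2) #|X| #|D| #|Y|; clear; nia.
  by move: DX XD; clear; lia.
(* Adding the doubles turns the diagonal pairs, counted by the Turán bound, into pairs with sum in
   the target set. *)
pose SA := S :|: [set (x + x)%R | x in A].
have cSA : #|SA| <= (4 * 2592).+1 * h ^ 2 * #|A|.
  apply: leq_trans (leq_card_setU _ _) _.
  have := leq_imset_card (fun x : 'F_p => (x + x)%R) A.
  have : 0 < h ^ 2 by rewrite expn_gt0 h0.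
  move: s4n nD DA; move: (h ^ 2) #|A| #|D| #|S| #|[set _ | _ in _]|; clear; nia.
have A0 : A != set0.
  rewrite -card_gt0; case: (posnP #|A|) DA mD => // ->; rewrite muln0 leqn0 => /eqP ->.
  by rewrite muln0 leqNgt m0.
have Aedges : #|A| ^ 2 <= h * \sum_(x in A) #|[set y in A | (x + y)%R \in SA]|.
  pose r' (x y : 'F_p) := (x == y) || ((x + y)%R \in SA).
  have r'refl : reflexive r' by move=> x; rewrite /r' eqxx.
  have r'sym : symmetric r' by move=> x y; rewrite /r' eq_sym addrC.
  have r'S x y : x \in A -> y \in A -> inS (x + y) -> r' x y.
    move=> /(subsetP AY)/US/small[_ hx] /(subsetP AY)/US/small[_ hy] hs.
    have lt : x + y < p by move: hx hy; clear; lia.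
    by rewrite /r' in_setU inSE ?orbT // val_addFp.
  apply: leq_trans (turan_independence r'refl r'sym (indep A r' AY r'S)) _.
  rewrite leq_mul2l; apply/orP; right; apply: leq_sum => x xA; apply: subset_leq_card.
  apply/subsetP => y; rewrite in_set => /andP[yA hr]; rewrite in_set yA /=.
  by case/orP: hr => [/eqP <-|//]; rewrite in_setU; apply/orP; right; apply/imsetP; exists x.
have [E [EA hAE hE]] := balog_szemeredi_gowers A0 Aedges.
have E0 : E != set0.
  apply: contraNneq A0 => E0; move: hAE; rewrite E0 cards0 muln0 leqn0 cards_eq0.
  by [].
(* 33 = 3 + 6 + 24: |SA|^4 <= h^24 |A|^4, the factors h^5 and 4h give 4h^6, and 4 * 1024 = 16^3 <=
   h^3. *)
have cEE : #|sumset E (oppset E)| <= h ^ 33 * #|E|.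
  have hA3 : 0 < #|A| ^ 3 by rewrite expn_gt0 card_gt0 A0.
  have hs : (4 * 2592).+1 * h ^ 2 <= h ^ 6.
    have -> : h ^ 6 = h ^ 4 * h ^ 2 by rewrite -expnD.
    rewrite leq_mul2r; apply/orP; right.
    by apply: (@leq_trans (16 ^ 4)) => //; rewrite leq_exp2r.
  have hs4 : #|SA| ^ 4 <= h ^ 24 * #|A| ^ 4.
    have -> : h ^ 24 = (h ^ 6) ^ 4 by rewrite -expnM.
    rewrite -expnMn leq_exp2r //.
    by apply: leq_trans cSA _; rewrite leq_mul2r hs orbT.
  rewrite -(leq_pmul2r hA3); apply: leq_trans hE _.
  apply: leq_trans (leq_mul (leqnn _) hs4) _.
  have h3 : 4096 <= h ^ 3 by apply: (@leq_trans (16 ^ 3)) => //; rewrite leq_exp2r.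
  apply: (@leq_trans (1024 * h ^ 5 * (h ^ 24 * (4 * h * #|E| * #|A| ^ 3)))).
    apply: leq_mul => //; apply: leq_mul => //; rewrite (expnS #|A| 3); exact: leq_mul.
  have -> : 1024 * h ^ 5 * (h ^ 24 * (4 * h * #|E| * #|A| ^ 3)) =
      4096 * (h ^ 6 * h ^ 24 * #|E| * #|A| ^ 3).
    by rewrite (expnS h 5); lia.
  have -> : h ^ 33 = h ^ 3 * (h ^ 6 * h ^ 24) by rewrite -!expnD.
  apply: (@leq_trans (h ^ 3 * (h ^ 6 * h ^ 24 * #|E| * #|A| ^ 3))); last by rewrite !mulnA.
  by rewrite leq_mul2r h3 orbT.
have := plunnecke_double_difference E0 cEE; rewrite -ltnS => hpl.
have [A' [f [A'E EA' fN hf]]] := ruzsa_model pp hpl.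
set N := (_ * _).+1 in fN hf.
pose B : pred nat := fun i => [exists x in A', f x == i].
have finj : {in A' &, injective f}.
  by move=> x y xA yA e; have := hf x y y xA yA yA; rewrite e => /(_ erefl)/addIr.
have cB : count_below N B = #|A'|.
  rewrite -(@card_in_imset _ _ (fun x => Ordinal (fN x))); last first.
    by move=> x y xA yA [] /finj; apply.
  rewrite -sum1_card [RHS]big_mkcond; apply: eq_bigr => i _.
  have -> : (i \in [set Ordinal (fN x) | x in A']) = B i.
    apply/imsetP/existsP => [[x xA ->]|[x /andP[xA /eqP fx]]]; exists x => //.
      by rewrite xA eqxx.
    exact: val_inj.
  by case: (B i).
have BN y : B y -> y < N by move=> /existsP[x /andP[_ /eqP <-]].
have dense : N <= density_const h * count_below N B.
  rewrite cB /N /density_const; have : 0 < (h ^ 33) ^ 4 * #|E|.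
    by rewrite muln_gt0 !expn_gt0 h0 card_gt0 E0.
  by move: EA'; move: ((h ^ 33) ^ 4) #|E| #|A'|; clear; nia.
have q0 : 0 < density_const h by rewrite /density_const muln_gt0 !expn_gt0 h0.
have [s [us ss /allP sB hs]] : midpoint_clique h B.
  apply: (dense_midpoint_clique q0 BN dense (k := clique_const h)); first exact: leq_addl.
  (* The successive losses 2, 1296 h^2, 2 and 4h multiply to 16 * 1296 h^3, and 16 * 1296 <= h^4. *)
  have YE : #|Y| <= h ^ 7 * #|E|.
    apply: (@leq_trans (16 * 1296 * h ^ 3 * #|E|)).
      rewrite (expnS h 2); move: Y2n nD DA hAE; move: (h ^ 2) #|Y| #|D| #|A| #|E|; clear; nia.
    have -> : h ^ 7 = h ^ 4 * h ^ 3 by rewrite -expnD.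
    rewrite leq_mul2r leq_mul2r; apply/orP; right; apply/orP; right.
    by apply: (@leq_trans (16 ^ 4)) => //; rewrite leq_exp2r.
  have h7 : 0 < h ^ 7 by rewrite expn_gt0 h0.
  have := leq_trans large YE; rewrite leq_pmul2l // => /leq_trans; apply.
  by rewrite /N leqW // leq_pmull // !expn_gt0 h0.
(* Pull the clique back through the model. A midpoint relation there gives x + y = 2z with [z] in
   [A], and 2z is outside [S]; this contradicts [noZ]. *)
pose Z := [set x in A' | f x \in s].
have /negP[] := noZ Z.
have ZA x : x \in Z -> x \in A'  by rewrite inE => /andP[].
have A'A := subset_trans A'E EA.
rewrite (subset_trans (subset_trans (introT subsetP ZA) A'A) AY) /=; apply/andP; split.
  rewrite -ss cardE -(size_map f); apply/eqP/perm_size/uniq_perm => //.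
    rewrite map_inj_in_uniq ?enum_uniq // => x y; rewrite !mem_enum => /ZA xA /ZA yA.
    exact: finj.
  move=> i; apply/mapP/idP => [[x]|iS]; first by rewrite mem_enum inE => /andP[_ + ->].
  have /existsP[x /andP[xA /eqP fx]] := sB i iS; exists x => //.
  by rewrite mem_enum inE xA fx.
apply/forall_inP => x xZ; apply/forall_inP => y yZ; apply/implyP => xy.
have xA := ZA x xZ; have yA := ZA y yZ.
have fxy : f x != f y by apply: contraNneq xy => /finj ->.
have fs z : z \in Z -> f z \in s by rewrite inE => /andP[].
have [_ /existsP[z /andP[zA /eqP <-]] e] := hs _ _ (fs x xZ) (fs y yZ) fxy.
have := hf x y z xA yA zA; rewrite e => /(_ erefl) exy.
have lt (u : 'F_p) : u \in A' -> 4 * u < p.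
  by move=> /(subsetP A'A)/(subsetP AY)/US/small[].
have := Adbl z (subsetP A'A z zA).
have e1 : (x + y)%R = x + y :> nat.
  by apply: val_addFp => //; move: (lt x xA) (lt y yA); clear; lia.
have e2 : (z + z)%R = z + z :> nat.
  by apply: val_addFp => //; move: (lt z zA); clear; lia.
by rewrite -e1 -e2 exy.
Qed.

(** * Real bounds and transfer to finite sets of integers *)

Local Open Scope ring_scope.

Lemma natr_exp2_le_expR (R : realType) (n : nat) (x : R) :
  n%:R <= x -> (2 ^ n)%N%:R <= expR x.
Proof.
move=> nx; apply: le_trans (_ : expR n%:R <= _); last by rewrite ler_expR.
rewrite -[n%:R]mulr1 expRM_natl natrX lerXn2r ?nnegrE ?expR_ge0 ?ler0n //.
by apply: le_trans (expR_ge1Dx 1).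
Qed.

(** Each exponential dominates one power of 2, and innermost h^4 <= h^32770. *)
Lemma G_ge (R : realType) (h : nat) : (16 <= h)%N -> (2 ^ 2 ^ 2 ^ (h ^ 4))%N%:R <= G 1 h :> R.
Proof.
move=> h16; have h1 : 1 <= h%:R :> R by rewrite ler1n (leq_trans _ h16).
apply: natr_exp2_le_expR; apply: (@le_trans _ _ (expR (expR (h ^ 4)%N%:R))).
  by apply: natr_exp2_le_expR; apply: natr_exp2_le_expR.
rewrite -[leLHS]mul1r ler_pM ?expR_ge0 ?exprn_ege1 //.
rewrite ler_expR mul1r -expRM_natl ler_expR natrX.
set m := (_ - 1)%N; have m1 : 1 <= m%:R :> R.
  by rewrite ler1n /m subn_gt0 addn1 -[1%N]muln1 ltn_mul // ?ltnS (leq_trans _ h16).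
rewrite -[leLHS]mul1r ler_pM ?ler01 ?exprn_ge0 ?ler0n // ler_weXn2l //.
Qed.

Lemma card_fset_ord (n : nat) (A : {fset nat}) :
  (forall x, x \in A -> (x < n)%N) -> #|[set i : 'I_n | val i \in A]| = #|` A|.
Proof.
move=> An; rewrite cardE -(size_map val); apply/perm_size/uniq_perm.
- by rewrite map_inj_uniq ?enum_uniq //; exact: val_inj.
- exact: fset_uniq.
move=> x; apply/mapP/idP => [[i]|xA]; first by rewrite mem_enum inE => iA ->.
by exists (Ordinal (An x xA)); rewrite ?mem_enum ?inE.
Qed.

Theorem theorem3p3 (R : realType) :
  exists (C : R) (h0 : nat), 0 < C /\
    forall (h : nat) (X Y : {fset nat}),
      (h0 <= h)%N ->
      (forall x, x \in X -> (0 < x)%N) ->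
      (forall y, y \in Y -> (0 < y)%N) ->
      (#|` X|)%:R <= 1 / h%:R ^+ 29 * (#|` Y|)%:R :> R ->
      G C h <= (#|` X|)%:R ->
      exists Z : {fset nat},
        [/\ (Z `<=` Y)%fset, #|` Z| = h, [disjoint Z & X]%fset
          & sum_free_wrt (X `|` Y)%fset Z].
Proof.
(* h >= 16 lets powers of [h] absorb all numerical constants of the argument. *)
exists 1, 16%N; split=> // h X Y h16 X0 Y0 XY GX.
have h0 : (0 < h)%N by exact: leq_trans h16.
have XYn : (#|` X| * h ^ 29 <= #|` Y|)%N.
  move: XY; rewrite mul1r mulrC ler_pdivlMr ?exprn_gt0 ?ltr0n //.
  by rewrite -natrX -natrM ler_nat.
have large : (h ^ 7 * increment_bound (clique_const h) (clique_const h) <= #|` Y|)%N.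
  apply: leq_trans (size_bound h16) _; apply: leq_trans XYn.
  apply: (@leq_trans #|` X|); last by rewrite leq_pmulr // expn_gt0 h0.
  by rewrite -(ler_nat R); apply: le_trans GX; exact: G_ge.
pose S := (X `|` Y)%fset.
(* A prime exceeding four times the sum of [S] exceeds 4x for every [x] in [S]. *)
have [p Sp pp] := prime_above (4 * \sum_(i <- S) i).
have ltS x : x \in S -> (4 * x < p)%N.
  move=> xS; apply: leq_ltn_trans Sp; rewrite leq_mul2l /=.
  by rewrite (big_rem x) //= leq_addr.
(* [P] is the ordinal bound to which 'F_p unfolds; it equals [p] only propositionally. *)
pose P := (Zp_trunc (pdiv p)).+2; have eP : P = p by exact: Fp_cast.
have SP (A : {fset nat}) : {subset A <= S} -> forall x, x \in A -> (x < P)%N.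
  move=> AS x /AS/ltS; rewrite eP; apply: leq_ltn_trans; exact: leq_pmull.
have XS : {subset X <= S} by move=> x xX; rewrite inE xX.
have YS : {subset Y <= S} by move=> x xY; rewrite inE xY orbT.
pose lift (A : {fset nat}) : {set 'F_p} := [set i : 'I_P | val i \in A].
have cX : #|lift X| = #|` X| by exact: card_fset_ord (SP X XS).
have cY : #|lift Y| = #|` Y| by exact: card_fset_ord (SP Y YS).
have small (x : 'F_p) : x \in lift X :|: lift Y -> (0 < x)%N /\ (4 * x < p)%N.
  rewrite !inE => /orP[] xA; split; [exact: X0|exact/ltS/XS|exact: Y0|exact/ltS/YS].
have XYp : (#|lift X| * h ^ 29 <= #|lift Y|)%N by rewrite cX cY.
rewrite -cY in large; have [Z' [Z'Y cZ' Z'S]] := sum_avoiding_subset pp h16 small XYp large.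
pose Z : {fset nat} := [fset x in Y | x \in [seq val i | i in Z']]%fset.
have memZ (i : 'F_p) : (val i \in Z) = (i \in Z').
  rewrite !inE /= mem_map ?mem_enum; last exact: val_inj.
  apply/andP/idP => [[]|iZ] //; split=> //.
  by have := subsetP Z'Y i iZ; rewrite !inE => /andP[].
have ZY : {subset Z <= Y} by move=> x; rewrite !inE => /andP[].
clearbody Z; have ordZ x : x \in Z -> exists2 i : 'F_p, i \in Z' & x = val i.
  move=> xZ; have xP := SP Z (fun y yZ => YS y (ZY y yZ)) x xZ.
  by exists (Ordinal xP) => //; rewrite -memZ.
exists Z; split.
- by apply/fsubsetP.
- rewrite -(card_fset_ord (SP Z (fun y yZ => YS y (ZY y yZ)))) -cZ'.
  by apply: eq_card => i; rewrite inE; exact: memZ.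
- apply/fdisjointP => x /ordZ[i /(subsetP Z'Y) + ->].
  by rewrite !inE => /andP[].
apply/fdisjointP => s /imfsetP[[x y] /= + ->].
rewrite !inE /= => /andP[/andP[/ordZ[i iZ ->] /ordZ[j jZ ->]] ij].
have ij' : i != j by apply: contraNneq ij => ->.
apply: contra (Z'S i j iZ jZ ij') => hs.
have sP : (val i + val j < P)%N by apply: (SP S (fun _ h => h)); rewrite inE.
apply/existsP; exists (Ordinal sP : 'F_p); rewrite !inE /= eqxx andbT.
by move: hs; rewrite -in_fsetU.
Qed.
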